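(* Let $(C,w^C_\bullet)$ and $(D,w^D_\bullet)$ be even $A_\infty$-coalgebras and let $(N,w^L_\bullet,w^R_\bullet)$ be a commuting $(C,D)$-space whose left $C$-comodule and right $D$-comodule structures are both even. Then $N$ induces a functor $-\boxtimes_CN:\mathbf M_{[C,-]}\to\mathbf M^D$ from $A_\infty$-contramodules over $C$ to right $A_\infty$-comodules over $D$, given by the contratensor product.
   Context: $K$ is a field; $Vect^{\mathbb Z}$ is the category of graded $K$-vector spaces, closed symmetric monoidal with internal hom $[W',W]_p=\prod_{k\in\mathbb Z}Vect(W'_k,W_{k+p})$. Koszul sign conventions apply. $A_\infty$-coalgebra: graded space $C$ with $w_k:C\to C^{\otimes k}$ of degree $2-k$ ($k\ge1$), $\sum_{p+q+r=n}(-1)^{pq+r}(1^{\otimes p}\otimes w_q\otimes1^{\otimes r})w_{p+1+r}=0$ for $n\ge1$ ($p,r\geq 0$, $q\geq 1$), with $\prod_kw_k:C\to\prod_kC^{\otimes k}$ factoring through $\bigoplus_kC^{\otimes k}$. It is even if $w_k=0$ for $k$ odd. Left $A_\infty$-comodule: graded space $P$ with $w^P_k:P\to C^{\otimes k-1}\otimes P$ of degree $2-k$, $\sum_{p+q+r=n,\,q,r\ge1}(-1)^{pq+r}(1^{\otimes p}\otimes w_q\otimes1^{\otimes r-1}\otimes1_P)w^P_{p+1+r}+\sum_{a+b=n,\,b\ge1}(-1)^{ab}(1^{\otimes a}\otimes w^P_b)w^P_{a+1}=0$ for $n\ge1$. Right $A_\infty$-comodule over $D$: $w^P_k:P\to P\otimes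 D^{\otimes k-1}$ of degree $2-k$ with $\sum_{p+q+r=n,\,p,q\ge1}(-1)^{pq+r}(1_P\otimes1^{\otimes p-1}\otimes w_q\otimes1^{\otimes r})w^P_{p+1+r}+\sum_{b+c=n,\,b\ge1}(-1)^c(w^P_b\otimes1^{\otimes c})w^P_{c+1}=0$ for $n\geq 1$. A comodule is even if $w_k^P=0$ for $k$ odd. Morphisms in $\mathbf M^D$ are degree-preserving maps compatible with all structure maps. $A_\infty$-contramodule over $C$: let $w'_k$ have components $w'_k(\bar n)=(-1)^{k(\Sigma\bar n+1)}w_k(\bar n)$, where $w_k(\bar n):C_{-\Sigma\bar n-(2-k)}\to C_{-n_1}\otimes\dots\otimes C_{-n_k}$ is the component of $w_k$. A contramodule is a graded space $M$ with maps $t^M_k:[C^{\otimes k-1},M]\to M$ of degree $2-k$ ($k\ge1$) such that for each $n\ge1$, $\sum_{p+q+r=n,\,p\ge0,\,q,r\ge1}(-1)^{p+qr}t^M_{p+1+r}\circ[C^{\otimes p}\otimes w'_q\otimes C^{\otimes r-1},M]+\sum_{a+b=n,\,a\ge0,\,b\ge1}(-1)^at^M_{a+1}\circ[C^{\otimes a},t^M_b]=0$, where $[C^{\otimes a},[C^{\otimes b-1},M]]\cong[C^{\otimes a+b-1},M]$ is the isomorphism corresponding to right contramodules, identifying $F$ with $x\mapsto(y\mapsto F(x\otimes y))$. Morphisms in $\mathbf M_{[C,-]}$ are degree-preserving maps compatible with the structure maps. A $(C,D)$-space $(N,w^L_\bullet,w^R_\bullet)$ is a graded space $N$ with a left $C$-comodule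 structure $w^L_k:N\to C^{\otimes k-1}\otimes N$ and a right $D$-comodule structure $w^R_l:N\to N\otimes D^{\otimes l-1}$. It is commuting if $(w^L_k\otimes D^{\otimes l-1})\circ w^R_l=(C^{\otimes k-1}\otimes w^R_l)\circ w^L_k$ for all $k,l\ge1$. Contratensor product: for $(M,t^M_\bullet)\in\mathbf M_{[C,-]}$, $M\boxtimes_CN$ is the coequalizer of the two maps $\bigoplus_{k\ge1}[C^{\otimes k-1},M]\otimes N\rightrightarrows M\otimes N$ given on the $k$-th summand by $(ev\otimes N)\circ([C^{\otimes k-1},M]\otimes w^L_k)$ and $t^M_k\otimes N$, where $ev:[C^{\otimes k-1},M]\otimes C^{\otimes k-1}\to M$ is evaluation. Its right $D$-comodule structure is the one induced by the maps $M\otimes w^R_l:M\otimes N\to M\otimes N\otimes D^{\otimes l-1}$. *)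

(* Defs.v *)
From HB Require Import structures.
From mathcomp Require Import all_boot all_order all_algebra generic_quotient.
From mathcomp Require Import boolp.

Set Implicit Arguments.
Unset Strict Implicit.
Unset Printing Implicit Defensive.

Import Order.TTheory GRing.Theory Num.Theory.
Local Open Scope ring_scope.
Local Open Scope quotient_scope.

Definition gspace (K : fieldType) := int -> lmodType K.

(* Homogeneous maps of degree d are encoded as matrices of linear maps        *)
(* V_i -> W_j that vanish off j = i + d, so that composites never need a      *)
(* transport along an equality of degrees. An element of ghom d V W is thus a *)
(* family of linear maps V_i -> W_(i + d), i.e. an element of [V, W]_d.       *)
Section GHom.
Variables (K : fieldType) (d : int) (V W : gspace K).

Record ghom : Type := GHom {
  gfun :> forall i j : int, V i -> W j;
  gfun_linear : forall i j, linear (@gfun i j);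
  gfun_deg : forall i j (x : V i), j != i + d -> gfun j x = 0 }.

HB.instance Definition _ (f : ghom) i j :=
  GRing.isLinear.Build K (V i) (W j) _ (@gfun f i j) (@gfun_linear f i j).

Lemma ghom_ext (f g : ghom) : (forall i j x, f i j x = g i j x) -> f = g.
Proof.
case: f g => [f lf df] [g lg dg] /= fg.
have E : f = g.
  apply: functional_extensionality_dep => i.
  apply: functional_extensionality_dep => j.
  by apply: functional_extensionality_dep => x.
by case: _ / E lg dg => lg dg; congr GHom; apply: Prop_irrelevance.
Qed.

HB.instance Definition _ := gen_eqMixin ghom.
HB.instance Definition _ := gen_choiceMixin ghom.

Definition ghom0 : ghom.
Proof.
refine (@GHom (fun i j _ => 0) _ _) => // i j a u v.
by rewrite scaler0 addr0.
Defined.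

Definition ghom_add (f g : ghom) : ghom.
Proof.
refine (@GHom (fun i j x => f i j x + g i j x) _ _).
- by move=> i j a u v; rewrite !linearP scalerDr addrACA.
- by move=> i j x ji; rewrite !gfun_deg // addr0.
Defined.

Definition ghom_opp (f : ghom) : ghom.
Proof.
refine (@GHom (fun i j x => - f i j x) _ _).
- by move=> i j a u v; rewrite linearP opprD scalerN.
- by move=> i j x ji; rewrite gfun_deg // oppr0.
Defined.

Definition ghom_scale (c : K) (f : ghom) : ghom.
Proof.
refine (@GHom (fun i j x => c *: f i j x) _ _).
- by move=> i j a u v; rewrite linearP scalerDr !scalerA mulrC.
- by move=> i j x ji; rewrite gfun_deg // scaler0.
Defined.

Fact ghom_addA : associative ghom_add.
Proof. by move=> f g h; apply: ghom_ext => i j x /=; rewrite addrA. Qed.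
Fact ghom_addC : commutative ghom_add.
Proof. by move=> f g; apply: ghom_ext => i j x /=; rewrite addrC. Qed.
Fact ghom_add0 : left_id ghom0 ghom_add.
Proof. by move=> f; apply: ghom_ext => i j x /=; rewrite add0r. Qed.
Fact ghom_addN : left_inverse ghom0 ghom_opp ghom_add.
Proof. by move=> f; apply: ghom_ext => i j x /=; rewrite addNr. Qed.
HB.instance Definition _ :=
  GRing.isZmodule.Build ghom ghom_addA ghom_addC ghom_add0 ghom_addN.

Fact ghom_scaleA a b f : ghom_scale a (ghom_scale b f) = ghom_scale (a * b) f.
Proof. by apply: ghom_ext => i j x /=; rewrite scalerA. Qed.
Fact ghom_scale1 : left_id 1 ghom_scale.
Proof. by move=> f; apply: ghom_ext => i j x /=; rewrite scale1r. Qed.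
Fact ghom_scaleDr : right_distributive ghom_scale +%R.
Proof. by move=> a f g; apply: ghom_ext => i j x /=; rewrite scalerDr. Qed.
Fact ghom_scaleDl f : {morph ghom_scale^~ f : a b / a + b}.
Proof. by move=> a b; apply: ghom_ext => i j x /=; rewrite scalerDl. Qed.
HB.instance Definition _ := GRing.Zmodule_isLmodule.Build K ghom
  ghom_scaleA ghom_scale1 ghom_scaleDr ghom_scaleDl.

End GHom.

Definition ihom (K : fieldType) (V W : gspace K) : gspace K :=
  fun d => ghom d V W.

(* Equality of homogeneous maps whose degrees are only provably equal. *)
Definition geq (K : fieldType) d e (V W : gspace K)
    (f : ghom d V W) (g : ghom e V W) : Prop :=
  forall i j x, f i j x = g i j x.
Infix "=g" := geq (at level 70).

Section GHomOps.
Variable K : fieldType.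
Implicit Types V W X M : gspace K.

Definition gid_fun V i j (x : V i) : V j :=
  if i =P j is ReflectT e then ecast k (V k) e x else 0.

Fact gid_linear V i j : linear (@gid_fun V i j).
Proof.
move=> a u v; rewrite /gid_fun; case: eqP => [e|_]; first by case: _ / e.
by rewrite scaler0 addr0.
Qed.

Fact gid_deg V i j (x : V i) : j != i + 0 -> gid_fun j x = 0.
Proof.
by rewrite addr0 /gid_fun => ji; case: eqP => // e; rewrite e eqxx in ji.
Qed.

Definition gid V : ghom 0 V V := GHom (@gid_linear V) (@gid_deg V).

Section Comp.
Variables (d e : int) (V W X : gspace K) (g : ghom e W X) (f : ghom d V W).

Definition gcomp_fun i j (x : V i) : X j := g (i + d) j (f i (i + d) x).

Fact gcomp_linear i j : linear (@gcomp_fun i j).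
Proof. by move=> a u v; rewrite /gcomp_fun !linearP. Qed.

Fact gcomp_deg i j (x : V i) : j != i + (d + e) -> gcomp_fun j x = 0.
Proof. by move=> ji; rewrite /gcomp_fun gfun_deg // -addrA. Qed.

Definition gcomp : ghom (d + e) V X := GHom gcomp_linear gcomp_deg.
End Comp.

(* Degree-preserving maps compose in degree 0 rather than 0 + 0. *)
Section Comp0.
Variables (V W X : gspace K) (g : ghom 0 W X) (f : ghom 0 V W).

Definition gcomp0_fun i j (x : V i) : X j := g i j (f i i x).

Fact gcomp0_linear i j : linear (@gcomp0_fun i j).
Proof. by move=> a u v; rewrite /gcomp0_fun !linearP. Qed.

Fact gcomp0_deg i j (x : V i) : j != i + 0 -> gcomp0_fun j x = 0.
Proof. by move=> ji; rewrite /gcomp0_fun gfun_deg. Qed.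

Definition gcomp0 : ghom 0 V X := GHom gcomp0_linear gcomp0_deg.
End Comp0.

(* The map [f, M] : [W, M] -> [V, M], phi |-> (-1)^(|f||phi|) phi \o f. *)
Section Pre.
Variables (d : int) (V W M : gspace K) (f : ghom d V W).

Definition ihom_pre_val i j (phi : ihom W M i) a b (x : V a) : M b :=
  if j == i + d then (-1) ^ (d * i) *: phi (a + d) b (f a (a + d) x) else 0.

Fact ihom_pre_val_linear i j phi a b : linear (@ihom_pre_val i j phi a b).
Proof.
move=> c u v; rewrite /ihom_pre_val; case: eqP => _; first by rewrite !linearP.
by rewrite scaler0 addr0.
Qed.

Fact ihom_pre_val_deg i j phi a b (x : V a) :
  b != a + j -> @ihom_pre_val i j phi a b x = 0.
Proof.
move=> ba; rewrite /ihom_pre_val; case: eqP => // ij; rewrite ij in ba.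
by rewrite gfun_deg ?scaler0 // -addrA [d + i]addrC.
Qed.

Definition ihom_pre_fun i j (phi : ihom W M i) : ihom V M j :=
  GHom (@ihom_pre_val_linear i j phi) (@ihom_pre_val_deg i j phi).

Fact ihom_pre_linear i j : linear (@ihom_pre_fun i j).
Proof.
move=> c u v; apply: ghom_ext => a b x /=; rewrite /ihom_pre_val.
case: eqP => _; last by rewrite scaler0 addr0.
by rewrite scalerDr !scalerA mulrC.
Qed.

Fact ihom_pre_deg i j (phi : ihom W M i) :
  j != i + d -> ihom_pre_fun j phi = 0.
Proof.
by move=> /negbTE ji; apply: ghom_ext => a b x /=; rewrite /ihom_pre_val ji.
Qed.

Definition ihom_pre : ghom d (ihom W M) (ihom V M) :=
  GHom ihom_pre_linear ihom_pre_deg.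
End Pre.

(* The map [V, g] : [V, M] -> [V, X], phi |-> g \o phi. *)
Section Post.
Variables (d : int) (V M X : gspace K) (g : ghom d M X).

Definition ihom_post_val i j (phi : ihom V M i) a b (x : V a) : X b :=
  if j == i + d then g (a + i) b (phi a (a + i) x) else 0.

Fact ihom_post_val_linear i j phi a b : linear (@ihom_post_val i j phi a b).
Proof.
move=> c u v; rewrite /ihom_post_val; case: eqP => _.
  by rewrite !linearP.
by rewrite scaler0 addr0.
Qed.

Fact ihom_post_val_deg i j phi a b (x : V a) :
  b != a + j -> @ihom_post_val i j phi a b x = 0.
Proof.
move=> ba; rewrite /ihom_post_val; case: eqP => // ij; rewrite ij in ba.
by rewrite gfun_deg // -addrA.
Qed.

Definition ihom_post_fun i j (phi : ihom V M i) : ihom V X j :=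
  GHom (@ihom_post_val_linear i j phi) (@ihom_post_val_deg i j phi).

Fact ihom_post_linear i j : linear (@ihom_post_fun i j).
Proof.
move=> c u v; apply: ghom_ext => a b x /=; rewrite /ihom_post_val.
case: eqP => _; last by rewrite scaler0 addr0.
by rewrite !linearP.
Qed.

Fact ihom_post_deg i j (phi : ihom V M i) :
  j != i + d -> ihom_post_fun j phi = 0.
Proof.
by move=> /negbTE ji; apply: ghom_ext => a b x /=; rewrite /ihom_post_val ji.
Qed.

Definition ihom_post : ghom d (ihom V M) (ihom V X) :=
  GHom ihom_post_linear ihom_post_deg.
End Post.
End GHomOps.

(* ptens [:: V1; ...; Vk] is the type of tuples (x1, ..., xk) of homogeneous  *)
(* elements, which stand for the pure tensors x1 (x) ... (x) xk.              *)
Section Tensor.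
Variable K : fieldType.
Implicit Types (V : gspace K) (s t : seq (gspace K)).

Fixpoint ptens s : Type :=
  if s is V :: s' then ({p : int & V p} * ptens s')%type else unit.

Fixpoint pdeg s : ptens s -> int :=
  if s is V :: s' then fun x => tag x.1 + pdeg x.2 else fun=> 0.

Fixpoint pcat s t : ptens s -> ptens t -> ptens (s ++ t) :=
  if s is V :: s' then fun x y => (x.1, pcat x.2 y) else fun _ y => y.

Fixpoint psplit s t : ptens (s ++ t) -> ptens s * ptens t :=
  if s is V :: s'
  then fun z => let u := psplit z.2 in ((z.1, u.1), u.2) else fun z => (tt, z).

Fixpoint multilinear (Z : lmodType K) s : (ptens s -> Z) -> Prop :=
  if s is V :: s' then fun phi =>
    (forall p (y : ptens s'), linear (fun v : V p => phi (existT _ p v, y)))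
    /\ (forall v, multilinear (fun y => phi (v, y)))
  else fun=> True.

(* The degree n part of V1 (x) ... (x) Vk is the sum over n1 + ... + nk = n   *)
(* of the spaces V1_(n1) (x) ... (x) Vk_(nk). It is realized by formal        *)
(* combinations of pure tensors, of which only the terms of degree n are      *)
(* counted, modulo having the same image under all multilinear maps; see      *)
(* tlift_pure, pure_multilinear and tens_ext for the universal property.      *)
Definition fcomb s := seq (K * ptens s).
HB.instance Definition _ s := gen_eqMixin (fcomb s).
HB.instance Definition _ s := gen_choiceMixin (fcomb s).

Definition feval (Z : lmodType K) s n (phi : ptens s -> Z) (c : fcomb s) : Z :=
  \sum_(ax <- c | pdeg ax.2 == n) ax.1 *: phi ax.2.

Definition tens_equiv s n : rel (fcomb s) := fun c c' =>
  `[< forall (Z : lmodType K) (phi : ptens s -> Z),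
        multilinear phi -> feval n phi c = feval n phi c' >].

Fact tens_equiv_refl s n : reflexive (@tens_equiv s n).
Proof. by move=> c; apply/asboolP. Qed.
Fact tens_equiv_sym s n : symmetric (@tens_equiv s n).
Proof.
by move=> c c'; apply/asboolP/asboolP => H Z phi mphi; rewrite H.
Qed.
Fact tens_equiv_trans s n : transitive (@tens_equiv s n).
Proof.
move=> c' c c'' /asboolP H /asboolP H'.
by apply/asboolP => Z phi mphi; rewrite H // H'.
Qed.
Canonical tens_equiv_rel s n :=
  EquivRel (@tens_equiv s n) (@tens_equiv_refl s n) (@tens_equiv_sym s n)
           (@tens_equiv_trans s n).

Definition tens_part s n := {eq_quot tens_equiv_rel s n}.
HB.instance Definition _ s n := Choice.on (tens_part s n).

Section Lift.
Variables (s : seq (gspace K)) (n : int).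
Implicit Types (x y z : tens_part s n) (c : fcomb s).

Definition tlift (Z : lmodType K) (phi : ptens s -> Z) x : Z :=
  feval n phi (repr x).

Lemma tlift_pi (Z : lmodType K) (phi : ptens s -> Z) c :
  multilinear phi -> tlift phi (\pi_(tens_part s n) c) = feval n phi c.
Proof.
move=> mphi; rewrite /tlift; case: piP => c' /eqquotP /asboolP H.
by rewrite -H.
Qed.

Lemma tlift_ext x y :
  (forall (Z : lmodType K) (phi : ptens s -> Z),
     multilinear phi -> tlift phi x = tlift phi y) -> x = y.
Proof.
move=> H; rewrite -[x]reprK -[y]reprK; apply/eqquotP/asboolP.
by move=> Z phi mphi; apply: H.
Qed.

Definition tens0 : tens_part s n := \pi_(tens_part s n) [::].
Definition tens_add x y : tens_part s n := \pi_(tens_part s n) (repr x ++ repr y).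
Definition tens_scale a x : tens_part s n :=
  \pi_(tens_part s n) [seq (a * bx.1, bx.2) | bx <- repr x].
Definition tens_opp x := tens_scale (-1) x.

Section LiftMorph.
Variables (Z : lmodType K) (phi : ptens s -> Z).
Hypothesis mphi : multilinear phi.
Fact tlift0 : tlift phi tens0 = 0.
Proof. by rewrite tlift_pi // /feval big_nil. Qed.
Fact tliftD x y : tlift phi (tens_add x y) = tlift phi x + tlift phi y.
Proof. by rewrite tlift_pi // /feval big_cat. Qed.
Fact tliftZ a x : tlift phi (tens_scale a x) = a *: tlift phi x.
Proof.
rewrite tlift_pi // /tlift /feval big_map scaler_sumr.
by apply: eq_bigr => bx _; rewrite scalerA.
Qed.
End LiftMorph.

Fact tens_addA : associative tens_add.
Proof. by move=> x y z; apply: tlift_ext => Z phi m; rewrite !tliftD // addrA. Qed.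
Fact tens_addC : commutative tens_add.
Proof. by move=> x y; apply: tlift_ext => Z phi m; rewrite !tliftD // addrC. Qed.
Fact tens_add0 : left_id tens0 tens_add.
Proof.
by move=> x; apply: tlift_ext => Z phi m; rewrite !tliftD // tlift0 // add0r.
Qed.
Fact tens_addN : left_inverse tens0 tens_opp tens_add.
Proof.
move=> x; apply: tlift_ext => Z phi m.
by rewrite tliftD // tliftZ // tlift0 // scaleN1r addNr.
Qed.
HB.instance Definition _ :=
  GRing.isZmodule.Build (tens_part s n) tens_addA tens_addC tens_add0 tens_addN.

Fact tens_scaleA a b x : tens_scale a (tens_scale b x) = tens_scale (a * b) x.
Proof. by apply: tlift_ext => Z phi m; rewrite !tliftZ // scalerA. Qed.
Fact tens_scale1 : left_id 1 tens_scale.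
Proof. by move=> x; apply: tlift_ext => Z phi m; rewrite !tliftZ // scale1r. Qed.
Fact tens_scaleDr : right_distributive tens_scale +%R.
Proof.
move=> a x y; apply: tlift_ext => Z phi m.
by rewrite tliftZ // !tliftD // scalerDr !tliftZ.
Qed.
Fact tens_scaleDl x : {morph tens_scale^~ x : a b / a + b}.
Proof.
move=> a b; apply: tlift_ext => Z phi m.
by rewrite tliftZ // scalerDl tliftD // !tliftZ.
Qed.
HB.instance Definition _ := GRing.Zmodule_isLmodule.Build K (tens_part s n)
  tens_scaleA tens_scale1 tens_scaleDr tens_scaleDl.

End Lift.

Definition tens s : gspace K := fun n => tens_part s n.

(* The class of x in degree n; it is zero unless n = pdeg x. *)
Definition pure s n (x : ptens s) : tens s n :=
  \pi_(tens_part s n) [:: (1, x)].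

Lemma tlift_linear s n (Z : lmodType K) (phi : ptens s -> Z) :
  multilinear phi -> linear (@tlift s n Z phi).
Proof.
move=> m a x y; rewrite -[LHS]/(tlift phi (tens_add (tens_scale a x) y)).
by rewrite tliftD // tliftZ.
Qed.

Lemma tlift_pure s n (Z : lmodType K) (phi : ptens s -> Z) x :
  multilinear phi -> tlift phi (pure n x) = if pdeg x == n then phi x else 0.
Proof.
move=> m; rewrite tlift_pi // /feval big_cons big_nil /=.
by case: ifP => // _; rewrite scale1r addr0.
Qed.

Lemma multilinear_linear (Z Z' : lmodType K) (g : Z -> Z') s (phi : ptens s -> Z) :
  linear g -> multilinear phi -> multilinear (fun x => g (phi x)).
Proof.
move=> lg; elim: s phi => //= V s IHs phi [h1 h2]; split.
  by move=> p y a u v; rewrite h1 lg.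
by move=> v; apply: IHs (h2 v).
Qed.

Lemma multilinear_deg (Z : lmodType K) s (phi : int -> ptens s -> Z) :
  (forall n, multilinear (phi n)) -> multilinear (fun x => phi (pdeg x) x).
Proof.
elim: s phi => //= V s IHs phi h; split.
  by move=> p y a u v /=; case: (h (p + pdeg y)) => ->.
move=> v; apply: (IHs (fun n y => phi (tag v + n) (v, y))) => n.
by case: (h (tag v + n)).
Qed.

Lemma multilinear_if (Z : lmodType K) s (b : bool) (phi : ptens s -> Z) :
  multilinear phi -> multilinear (fun x => if b then phi x else 0).
Proof.
apply: (multilinear_linear (g := fun z => if b then z else 0)).
by case: b => a u v //=; rewrite scaler0 addr0.
Qed.

Lemma multilinear_sum (Z : lmodType K) s (I : Type) (r : seq I) (P : pred I)
    (phi : I -> ptens s -> Z) :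
  (forall i, multilinear (phi i)) ->
  multilinear (fun x => \sum_(i <- r | P i) phi i x).
Proof.
elim: s phi => //= V s IHs phi h; split.
  move=> p y a u v; rewrite scaler_sumr -big_split /=.
  by apply: eq_bigr => i _; case: (h i) => ->.
by move=> v; apply: (IHs (fun i y => phi i (v, y))) => i; case: (h i).
Qed.

Lemma multilinear_tlift (Z : lmodType K) s t n (phi : ptens s -> ptens t -> Z)
    (y : tens t n) :
  (forall v, multilinear (phi^~ v)) ->
  multilinear (fun x => tlift (phi x) y).
Proof.
move=> h; apply: multilinear_sum => i.
by apply: multilinear_linear (h i.2) => a u v; rewrite scalerDr !scalerA mulrC.
Qed.

Lemma multilinear_catl (Z : lmodType K) s t (phi : ptens (s ++ t) -> Z) y :
  multilinear phi -> multilinear (fun x => phi (pcat x y)).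
Proof.
elim: s phi => //= V s IHs phi [h1 h2]; split; first by move=> *; apply: h1.
by move=> v; apply: IHs (h2 v).
Qed.

Lemma multilinear_catr (Z : lmodType K) s t (phi : ptens (s ++ t) -> Z) x :
  multilinear phi -> multilinear (fun y => phi (pcat x y)).
Proof. by elim: s phi x => //= V s IHs phi [v x] [_ h]; apply: IHs (h v). Qed.

Lemma multilinear_split (Z : lmodType K) s t (phi : ptens s -> ptens t -> Z) :
    (forall x, multilinear (phi x)) -> (forall y, multilinear (phi^~ y)) ->
  multilinear (fun z : ptens (s ++ t) => phi (psplit z).1 (psplit z).2).
Proof.
elim: s phi => [|V s IHs] phi h1 h2 /=; first exact: h1.
split; first by move=> p y; case: (h2 (psplit y).2).
move=> v; apply: (IHs (fun x y => phi (v, x) y)) => [x|y]; first exact: h1.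
by case: (h2 y) => _; apply.
Qed.

Lemma pure_multilinear s n : multilinear (@pure s n).
Proof.
have sep t (f : ptens t -> tens s n) :
    (forall (Z : lmodType K) (phi : ptens s -> Z), multilinear phi ->
       multilinear (fun x => tlift phi (f x))) -> multilinear f.
  elim: t f => //= V t IHt f h; split.
    move=> p y a u v; apply: tlift_ext => Z phi m.
    by rewrite (tlift_linear m); case: (h Z phi m) => ->.
  by move=> v; apply: IHt => Z phi m; case: (h Z phi m).
apply: sep => Z phi m.
have -> : (fun x => tlift phi (pure n x)) =
          fun x => if pdeg x == n then phi x else 0.
  by apply: functional_extensionality_dep => x; rewrite tlift_pure.
apply: (multilinear_deg (phi := fun d x => if d == n then phi x else 0)) => d.
exact: multilinear_if.
Qed.

Lemma pure_deg s n (x : ptens s) : pdeg x != n -> pure n x = 0.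
Proof.
move=> /negbTE xn; apply: tlift_ext => Z phi m.
by rewrite tlift_pure // xn -[X in _ = tlift _ X]/(tens0 s n) tlift0.
Qed.

Lemma tens_ext s n (Z : lmodType K) (f g : tens s n -> Z) :
    linear f -> linear g ->
  (forall x, pdeg x = n -> f (pure n x) = g (pure n x)) -> f =1 g.
Proof.
move=> lf lg fg x.
pose lin h (lh : linear h) : {linear tens s n -> Z} :=
  HB.pack h (GRing.isLinear.Build K (tens s n) Z _ h lh).
have -> : x = \sum_(ay <- repr x | pdeg ay.2 == n) ay.1 *: pure n ay.2.
  apply: tlift_ext => Z' phi m.
  pose T : {linear tens s n -> Z'} := HB.pack (@tlift s n Z' phi)
    (GRing.isLinear.Build K (tens s n) Z' _ _ (tlift_linear m)).
  rewrite -[RHS]/(T _) linear_sum; apply: eq_bigr => ay /eqP yn.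
  by rewrite linearZ -[T _]/(tlift phi _) tlift_pure // yn eqxx.
rewrite -[f _]/(lin f lf _) -[g _]/(lin g lg _) !linear_sum.
by apply: eq_bigr => ay /eqP yn; rewrite !linearZ; congr (_ *: _); apply: fg.
Qed.

Lemma tlift_eq0 s n (Z : lmodType K) (phi : ptens s -> Z) (x : tens s n) :
  (forall u, pdeg u = n -> phi u = 0) -> tlift phi x = 0.
Proof.
move=> h; rewrite /tlift /feval big1 // => u /eqP un.
by rewrite h // scaler0.
Qed.

Lemma tlift_morph s n (Z : lmodType K) (phi psi chi : ptens s -> Z) a
    (x : tens s n) :
  (forall u, phi u = a *: psi u + chi u) ->
  tlift phi x = a *: tlift psi x + tlift chi x.
Proof.
move=> h; rewrite /tlift /feval scaler_sumr -big_split /=.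
by apply: eq_bigr => u _; rewrite h scalerDr !scalerA mulrC.
Qed.

Lemma pdeg_cat s t (x : ptens s) (y : ptens t) :
  pdeg (pcat x y) = pdeg x + pdeg y.
Proof.
by elim: s x => [|V s IHs] /= x; rewrite ?add0r // IHs addrA.
Qed.

Lemma pdeg_split s t (z : ptens (s ++ t)) :
  pdeg (psplit z).1 + pdeg (psplit z).2 = pdeg z.
Proof.
by elim: s z => [|V s IHs] /= z; rewrite ?add0r // -addrA IHs.
Qed.

Lemma psplit_cat s t (x : ptens s) (y : ptens t) : psplit (pcat x y) = (x, y).
Proof. by elim: s x => [|V s IHs] /= [] // v x; rewrite IHs. Qed.

Lemma pcat_split s t (z : ptens (s ++ t)) :
  pcat (psplit z).1 (psplit z).2 = z.
Proof. by elim: s z => [|V s IHs] //= [v z]; rewrite IHs. Qed.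

(* The product x (x) y : (V1 (x) ... (x) Vk)_p x (W1 (x) ... (x) Wl)_q ->     *)
(* (V1 (x) ... (x) Vk (x) W1 (x) ... (x) Wl)_n, zero unless n = p + q.        *)
Definition tcat s t p q n (x : tens s p) (y : tens t q) : tens (s ++ t) n :=
  tlift (fun u => tlift (fun v => pure n (pcat u v)) y) x.

Lemma tcat_linear_l s t p q n (y : tens t q) :
  linear (fun x : tens s p => tcat n x y).
Proof.
apply: tlift_linear; apply: multilinear_tlift => v.
exact/multilinear_catl/pure_multilinear.
Qed.

Lemma tcat_linear_r s t p q n (x : tens s p) : linear (@tcat s t p q n x).
Proof.
move=> a y y'; apply: tlift_morph => u; apply: tlift_linear.
exact/multilinear_catr/pure_multilinear.
Qed.

Lemma tcat_deg s t p q n (x : tens s p) (y : tens t q) :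
  n != p + q -> tcat n x y = 0.
Proof.
move=> npq; apply: tlift_eq0 => u up; apply: tlift_eq0 => v vq.
by apply: pure_deg; rewrite pdeg_cat up vq eq_sym.
Qed.

(* The identity when s and t are equal lists, as they always are below. *)
Definition tcast s t n (x : tens s n) : tens t n :=
  if pselect (s = t) is left e then ecast u (tens u n) e x else 0.

Lemma tcast_id s n (x : tens s n) : tcast s x = x.
Proof.
rewrite /tcast; case: pselect => // e.
by rewrite (Prop_irrelevance e erefl).
Qed.

Lemma tcast_linear s t n : linear (@tcast s t n).
Proof.
move=> a x y; rewrite /tcast; case: pselect => [e|_]; first by case: _ / e.
by rewrite scaler0 addr0.
Qed.

Lemma tcast0 s t n : tcast t (0 : tens s n) = 0.
Proof. by rewrite /tcast; case: pselect => // e; case: _ / e. Qed.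

(* A map f defined on V, seen as a map on the one-fold tensor product of V,   *)
(* and dually for a map with values in W.                                     *)
Section OneFold.
Variables (d : int) (V W : gspace K) (f : ghom d V W).

Definition dom1_val j (z : ptens [:: V]) : W j := f (tag z.1) j (tagged z.1).

Lemma dom1_val_multilinear j : multilinear (@dom1_val j).
Proof. by split=> // p y a u v; rewrite /dom1_val /= linearP. Qed.

Fact dom1_deg i j (x : tens [:: V] i) :
  j != i + d -> tlift (@dom1_val j) x = 0.
Proof.
move=> ji; apply: tlift_eq0 => -[[p v] []] /=; rewrite addr0 => pi.
by rewrite /dom1_val gfun_deg //= pi.
Qed.

Definition dom1 : ghom d (tens [:: V]) W :=
  GHom (fun i j => tlift_linear (n := i) (dom1_val_multilinear j)) dom1_deg.

Definition cod1_fun i j (x : V i) : tens [:: W] j :=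
  @pure [:: W] j (existT _ (i + d) (f i (i + d) x), tt).

Fact cod1_linear i j : linear (@cod1_fun i j).
Proof.
move=> a u v; rewrite /cod1_fun linearP.
by have [h _] := @pure_multilinear [:: W] j; apply: h.
Qed.

Fact cod1_deg i j (x : V i) : j != i + d -> cod1_fun j x = 0.
Proof. by move=> ji; apply: pure_deg; rewrite /= addr0 eq_sym. Qed.

Definition cod1 : ghom d V (tens [:: W]) := GHom cod1_linear cod1_deg.
End OneFold.

(* tact a f b is the map 1 (x) f (x) 1 from a (x) s (x) b to a (x) t (x) b;   *)
(* it sends x (x) u (x) y to (-1)^(|f||x|) x (x) f(u) (x) y. Its source and   *)
(* target are given as lists s0 and t0 equal to a ++ s ++ b and a ++ t ++ b.  *)
Section TensorAct.
Variables (d : int) (a s t : seq (gspace K)) (f : ghom d (tens s) (tens t)).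
Variable b : seq (gspace K).

Definition tmid n j (x : ptens a) (w : tens t n) (y : ptens b) :
    tens (a ++ t ++ b) j :=
  tlift (fun v => pure j (pcat x (pcat v y))) w.

Lemma tmid_linear n j x y : linear (fun w : tens t n => tmid j x w y).
Proof.
apply: tlift_linear; apply: (multilinear_catl (phi := fun v => pure j (pcat x v))).
exact/multilinear_catr/pure_multilinear.
Qed.

Definition tact_val j (z : ptens (a ++ s ++ b)) : tens (a ++ t ++ b) j :=
  let x := (psplit z).1 in
  let u := (psplit (psplit z).2).1 in
  let y := (psplit (psplit z).2).2 in
  (-1) ^ (d * pdeg x) *: tmid j x (f _ (pdeg u + d) (pure (pdeg u) u)) y.

Lemma tact_val_multilinear j : multilinear (@tact_val j).
Proof.
pose phi x u y : tens (a ++ t ++ b) j := (-1) ^ (d * pdeg x) *: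
  tmid j x (f _ (pdeg u + d) (pure (pdeg u) u)) y.
have linZ (c : K) (Z : lmodType K) : linear (fun z : Z => c *: z).
  by move=> e v w; rewrite scalerDr !scalerA mulrC.
apply: (multilinear_split
  (phi := fun x uy => phi x (psplit uy).1 (psplit uy).2)) => [x|uy].
  apply: (multilinear_split (phi := phi x)) => [u|y].
    apply: multilinear_linear => //; apply: multilinear_tlift => v.
    apply: (multilinear_catr (phi := fun w => pure j (pcat x w))).
    exact/multilinear_catr/pure_multilinear.
  apply: (multilinear_deg (phi := fun n u => (-1) ^ (d * pdeg x) *:
            tmid j x (f n (n + d) (pure n u)) y)) => n.
  apply: multilinear_linear => //.
  apply: (multilinear_linear (g := fun w => tmid j x (f n (n + d) w) y)).
    by move=> e v w; rewrite linearP tmid_linear.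
  exact: pure_multilinear.
apply: (multilinear_deg (phi := fun n x => (-1) ^ (d * n) *: tmid j x
    (f _ (pdeg (psplit uy).1 + d) (pure _ (psplit uy).1)) (psplit uy).2)) => n.
apply: multilinear_linear => //; apply: multilinear_tlift => v.
exact/multilinear_catl/pure_multilinear.
Qed.

Lemma tact_val_deg j z : j != pdeg z + d -> tact_val j z = 0.
Proof.
move=> jz; rewrite /tact_val /tmid tlift_eq0 ?scaler0 // => v vn.
apply: pure_deg; apply: contra_neq jz => <-.
rewrite !pdeg_cat vn -(pdeg_split z) -(pdeg_split (psplit z).2) -!addrA.
by rewrite [d + _]addrC.
Qed.

Section Cast.
Variables s0 t0 : seq (gspace K).

Definition tact_fun i j (x : tens s0 i) : tens t0 j :=
  tcast t0 (tlift (@tact_val j) (tcast (a ++ s ++ b) x)).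

Fact tact_linear i j : linear (@tact_fun i j).
Proof.
move=> c u v; rewrite /tact_fun tcast_linear.
by rewrite (tlift_linear (@tact_val_multilinear j)) tcast_linear.
Qed.

Fact tact_deg i j (x : tens s0 i) : j != i + d -> tact_fun j x = 0.
Proof.
move=> ji; rewrite /tact_fun tlift_eq0; last first.
  by move=> z zi; rewrite tact_val_deg // zi.
exact: tcast0.
Qed.

Definition tact : ghom d (tens s0) (tens t0) := GHom tact_linear tact_deg.
End Cast.
End TensorAct.
End Tensor.
Arguments tact {K d} a {s t} f b {s0 t0}.

Section Hom.
Variable K : fieldType.
Implicit Types (M : gspace K) (r s t : seq (gspace K)).

(* Evaluation [V1 (x) ... (x) Vk, M] (x) V1 (x) ... (x) Vk -> M. *)
Section Eval.
Variables (s : seq (gspace K)) (M : gspace K).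

Definition ev_val j (z : ptens (ihom (tens s) M :: s)) : M j :=
  (tagged z.1 : ghom _ (tens s) M) (pdeg z.2) j (pure _ z.2).

Lemma ev_val_multilinear j : multilinear (@ev_val j).
Proof.
split=> // -[p phi].
apply: (multilinear_deg (phi := fun n x => (phi : ghom _ _ _) n j (pure n x))).
move=> n; apply: (multilinear_linear (g := (phi : ghom _ _ _) n j)).
  exact: gfun_linear.
exact: pure_multilinear.
Qed.

Fact ev_deg i j (x : tens (ihom (tens s) M :: s) i) :
  j != i + 0 -> tlift (@ev_val j) x = 0.
Proof.
rewrite addr0 => ji; apply: tlift_eq0 => -[[p phi] y] /= pi.
by rewrite /ev_val gfun_deg //= addrC pi.
Qed.

Definition ev : ghom 0 (tens (ihom (tens s) M :: s)) M :=
  GHom (fun i j => tlift_linear (n := i) (ev_val_multilinear j)) ev_deg.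
End Eval.

(* The isomorphism [s (x) t, M] -> [s, [t, M]], F |-> (x |-> (y |-> F (x (x)  *)
(* y))); its source is given as a list r equal to s ++ t.                     *)
Section Curry.
Variables (r s t : seq (gspace K)) (M : gspace K).

Definition icurry_val2 i j (F : ihom (tens r) M i) a b (x : tens s a)
    c e (y : tens t c) : M e :=
  if (i == j) && (b == a + j) then F (a + c) e (tcast r (tcat (a + c) x y))
  else 0.

Fact icurry_val2_linear i j F a b x c e : linear (@icurry_val2 i j F a b x c e).
Proof.
move=> k u v; rewrite /icurry_val2; case: ifP => _.
  by rewrite tcat_linear_r tcast_linear linearP.
by rewrite scaler0 addr0.
Qed.

Fact icurry_val2_deg i j F a b x c e (y : tens t c) :
  e != c + b -> @icurry_val2 i j F a b x c e y = 0.
Proof.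
move=> ecb; rewrite /icurry_val2; case: ifP => // /andP[/eqP ij /eqP bE].
by rewrite gfun_deg // ij addrAC addrC -bE.
Qed.

Definition icurry_val i j (F : ihom (tens r) M i) a b (x : tens s a) :
    ihom (tens t) M b :=
  GHom (@icurry_val2_linear i j F a b x) (@icurry_val2_deg i j F a b x).

Fact icurry_val_linear i j F a b : linear (@icurry_val i j F a b).
Proof.
move=> k u v; apply: ghom_ext => c e y /=; rewrite /icurry_val2.
case: ifP => _; last by rewrite scaler0 addr0.
by rewrite tcat_linear_l tcast_linear linearP.
Qed.

Fact icurry_val_deg i j F a b (x : tens s a) :
  b != a + j -> @icurry_val i j F a b x = 0.
Proof.
move=> /negbTE ba; apply: ghom_ext => c e y /=.
by rewrite /icurry_val2 ba andbF.
Qed.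

Definition icurry_fun i j (F : ihom (tens r) M i) :
    ihom (tens s) (ihom (tens t) M) j :=
  GHom (@icurry_val_linear i j F) (@icurry_val_deg i j F).

Fact icurry_linear i j : linear (@icurry_fun i j).
Proof.
move=> k F G; apply: ghom_ext => a b x; apply: ghom_ext => c e y /=.
rewrite /icurry_val2; case: ifP => _ //=.
by rewrite scaler0 addr0.
Qed.

Fact icurry_deg i j (F : ihom (tens r) M i) : j != i + 0 -> icurry_fun j F = 0.
Proof.
rewrite addr0 eq_sym => /negbTE ij; apply: ghom_ext => a b x.
by apply: ghom_ext => c e y /=; rewrite /icurry_val2 ij.
Qed.

Definition icurry : ghom 0 (ihom (tens r) M) (ihom (tens s) (ihom (tens t) M)) :=
  GHom icurry_linear icurry_deg.
End Curry.
End Hom.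

(* In all structures below the components are indexed by k >= 1 in the        *)
(* literature; the component of index 0 is set to 0.                          *)
Section Structures.
Variable K : fieldType.

Section Coalgebra.
Variables (C : gspace K) (w : forall k : nat, ghom (2 - k%:Z) C (tens (nseq k C))).

Definition coalg_rel : Prop := forall n, (0 < n)%N ->
  forall i j (x : C i),
  \sum_(p < n.+1) \sum_(q < n.+1) \sum_(r < n.+1
      | ((p + q + r)%N == n) && (0 < q)%N)
    (-1) ^+ (p * q + r) *:
      (gcomp (tact (nseq p C) (dom1 (w q)) (nseq r C)) (w (p + 1 + r)) i j x
         : tens (nseq n C) j) = 0.

(* The map prod_k w_k factors through the direct sum. *)
Definition coalg_fin : Prop := forall i (x : C i),
  exists m, forall k j, (m <= k)%N -> w k i j x = 0.
End Coalgebra.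

Record coalgebra := Coalgebra {
  coal_space : gspace K;
  coal_w : forall k : nat, ghom (2 - k%:Z) coal_space (tens (nseq k coal_space));
  coal_w0 : coal_w 0 = 0;
  coal_finP : coalg_fin coal_w;
  coal_relP : coalg_rel coal_w }.

Definition even_family (V : gspace K) (W : nat -> gspace K)
    (w : forall k : nat, ghom (2 - k%:Z) V (W k)) : Prop :=
  forall k, odd k -> w k = 0.

Definition even_coalgebra (C : coalgebra) : Prop :=
  @even_family (coal_space C) (fun k => tens (nseq k (coal_space C))) (coal_w C).

Section LeftComodule.
Variables (CC : coalgebra) (P : gspace K).
Let C := coal_space CC.
Variable w : forall k : nat, ghom (2 - k%:Z) P (tens (nseq k.-1 C ++ [:: P])).

Definition lcomod_rel : Prop := forall n, (0 < n)%N ->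
  forall i j (x : P i),
  \sum_(p < n.+1) \sum_(q < n.+1) \sum_(r < n.+1
      | [&& (p + q + r)%N == n, 0 < q & 0 < r]%N)
    (-1) ^+ (p * q + r) *:
      (gcomp (tact (nseq p C) (dom1 (coal_w CC q)) (nseq r.-1 C ++ [:: P]))
             (w (p + 1 + r)) i j x : tens (nseq n.-1 C ++ [:: P]) j)
  + \sum_(a < n.+1) \sum_(b < n.+1 | ((a + b)%N == n) && (0 < b)%N)
    (-1) ^+ (a * b) *:
      (gcomp (tact (nseq a C) (dom1 (w b)) [::]) (w (a + 1)) i j x
         : tens (nseq n.-1 C ++ [:: P]) j) = 0.
End LeftComodule.

Section RightComodule.
Variables (DD : coalgebra) (P : gspace K).
Let D := coal_space DD.
Variable w : forall k : nat, ghom (2 - k%:Z) P (tens (P :: nseq k.-1 D)).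

Definition rcomod_rel : Prop := forall n, (0 < n)%N ->
  forall i j (x : P i),
  \sum_(p < n.+1) \sum_(q < n.+1) \sum_(r < n.+1
      | [&& (p + q + r)%N == n, 0 < p & 0 < q]%N)
    (-1) ^+ (p * q + r) *:
      (gcomp (tact (P :: nseq p.-1 D) (dom1 (coal_w DD q)) (nseq r D))
             (w (p + 1 + r)) i j x : tens (P :: nseq n.-1 D) j)
  + \sum_(b < n.+1) \sum_(c < n.+1 | ((b + c)%N == n) && (0 < b)%N)
    (-1) ^+ c *:
      (gcomp (tact [::] (dom1 (w b)) (nseq c D)) (w (c + 1)) i j x
         : tens (P :: nseq n.-1 D) j) = 0.
End RightComodule.

Record rcomodule (D : coalgebra) := RComodule {
  rcom_space : gspace K;
  rcom_w : forall k : nat, ghom (2 - k%:Z) rcom_space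
             (tens (rcom_space :: nseq k.-1 (coal_space D)));
  rcom_w0 : rcom_w 0 = 0;
  rcom_relP : rcomod_rel rcom_w }.

(* The maps w'_k, with components (-1)^(k (n1 + ... + nk + 1)) w_k(n1, ..,    *)
(* nk) where n1 + ... + nk = - j on the target of degree j.                   *)
Section Twist.
Variables (k : nat) (V W : gspace K) (w : ghom (2 - k%:Z) V W).

Definition twist_fun i j (x : V i) : W j := (-1) ^ (k%:Z * (- j + 1)) *: w i j x.

Fact twist_linear i j : linear (@twist_fun i j).
Proof.
by move=> a u v; rewrite /twist_fun linearP scalerDr !scalerA mulrC.
Qed.

Fact twist_deg i j (x : V i) : j != i + (2 - k%:Z) -> twist_fun j x = 0.
Proof. by move=> ji; rewrite /twist_fun gfun_deg // scaler0. Qed.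

Definition twist : ghom (2 - k%:Z) V W := GHom twist_linear twist_deg.
End Twist.

Section Contramodule.
Variables (CC : coalgebra) (M : gspace K).
Let C := coal_space CC.
Variable t : forall k : nat, ghom (2 - k%:Z) (ihom (tens (nseq k.-1 C)) M) M.

Definition contra_rel : Prop := forall n, (0 < n)%N ->
  forall i j (phi : ihom (tens (nseq n.-1 C)) M i),
  \sum_(p < n.+1) \sum_(q < n.+1) \sum_(r < n.+1
      | [&& (p + q + r)%N == n, 0 < q & 0 < r]%N)
    (-1) ^+ (p + q * r) *:
      gcomp (t (p + 1 + r))
        (ihom_pre M
           (tact (nseq p C) (dom1 (twist (coal_w CC q))) (nseq r.-1 C)))
        i j phi
  + \sum_(a < n.+1) \sum_(b < n.+1 | ((a + b)%N == n) && (0 < b)%N)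
    (-1) ^+ a *:
      gcomp (t a.+1)
        (gcomp (ihom_post (tens (nseq a C)) (t b))
               (icurry (nseq n.-1 C) (nseq a C) (nseq b.-1 C) M))
        i j phi = 0.
End Contramodule.

Record contramodule (C : coalgebra) := Contramodule {
  con_space : gspace K;
  con_t : forall k : nat, ghom (2 - k%:Z)
            (ihom (tens (nseq k.-1 (coal_space C))) con_space) con_space;
  con_t0 : con_t 0 = 0;
  con_relP : contra_rel con_t }.

Record cdspace (C D : coalgebra) := CDSpace {
  cd_space : gspace K;
  cd_wL : forall k : nat, ghom (2 - k%:Z) cd_space
            (tens (nseq k.-1 (coal_space C) ++ [:: cd_space]));
  cd_wL0 : cd_wL 0 = 0;
  cd_wL_relP : lcomod_rel cd_wL;
  cd_wR : forall k : nat, ghom (2 - k%:Z) cd_space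
            (tens (cd_space :: nseq k.-1 (coal_space D)));
  cd_wR0 : cd_wR 0 = 0;
  cd_wR_relP : rcomod_rel cd_wR }.

Definition commuting (C D : coalgebra) (N : cdspace C D) : Prop :=
  forall k l, (0 < k)%N -> (0 < l)%N ->
    (gcomp (tact [::] (dom1 (cd_wL N k)) (nseq l.-1 (coal_space D))) (cd_wR N l)
       : ghom _ _ (tens (nseq k.-1 (coal_space C) ++
                         cd_space N :: nseq l.-1 (coal_space D))))
    =g gcomp (tact (nseq k.-1 (coal_space C)) (dom1 (cd_wR N l)) [::])
             (cd_wL N k).
End Structures.

Record category := Category {
  obj :> Type;
  mor : obj -> obj -> Type;
  idm : forall A, mor A A;
  compm : forall A B C, mor B C -> mor A B -> mor A C;
  compm1 : forall A B (f : mor A B), compm f (idm A) = f;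
  comp1m : forall A B (f : mor A B), compm (idm B) f = f;
  compmA : forall A B C D (f : mor A B) (g : mor B C) (h : mor C D),
    compm h (compm g f) = compm (compm h g) f }.

Record functor (A B : category) := Functor {
  fobj :> A -> B;
  fmap : forall X Y : A, mor X Y -> mor (fobj X) (fobj Y);
  fmap1 : forall X : A, fmap (idm X) = idm (fobj X);
  fmapM : forall (X Y Z : A) (f : mor X Y) (g : mor Y Z),
    fmap (compm g f) = compm (fmap g) (fmap f) }.

Section Functoriality.
Variable K : fieldType.
Implicit Types (V W X : gspace K).

Lemma gid_id V i (x : V i) : gid V i i x = x.
Proof.
rewrite /= /gid_fun; case: eqP => // e.
by rewrite (Prop_irrelevance e erefl).
Qed.

Lemma gcomp0_id V W (f : ghom 0 V W) : gcomp0 f (gid V) = f.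
Proof. by apply: ghom_ext => i j x; rewrite /= /gcomp0_fun gid_id. Qed.

Lemma gcomp_id V W (f : ghom 0 V W) : gcomp0 (gid W) f = f.
Proof.
apply: ghom_ext => i j x; rewrite /= /gcomp0_fun.
have [<-|ij] := eqVneq i j; first exact: gid_id.
by rewrite gid_deg ?addr0 1?eq_sym // gfun_deg // addr0 eq_sym.
Qed.

Lemma gcomp_val d e V W X (g : ghom e W X) (f : ghom d V W) i j x :
  gcomp g f i j x = g (i + d) j (f i (i + d) x).
Proof. by []. Qed.

Lemma gcompE d V W X (g : ghom d W X) (f : ghom 0 V W) i j x :
  gcomp g f i j x = g i j (f i i x).
Proof. by rewrite /= /gcomp_fun addr0. Qed.

Lemma tact_pure a s t b d (f : ghom d (tens s) (tens t)) i j k l x u y :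
    pdeg u = k -> l = k + d -> i = pdeg x + (k + pdeg y) ->
  tact a f b i j (@pure K (a ++ s ++ b) i (pcat x (pcat u y)))
  = (-1) ^ (d * pdeg x) *: tmid j x (f k l (pure k u)) y
  :> tens (a ++ t ++ b) j.
Proof.
move=> <- -> ->; rewrite /= /tact_fun !tcast_id tlift_pure; last first.
  exact: tact_val_multilinear.
by rewrite !pdeg_cat eqxx /tact_val !psplit_cat.
Qed.

Lemma tact_tmid a s t b d (f : ghom d (tens s) (tens t)) n j x (w : tens s n) y :
  tact a f b (pdeg x + (n + pdeg y)) j (@tmid K a s b n _ x w y)
  = (-1) ^ (d * pdeg x) *: tmid j x (f n (n + d) w) y :> tens (a ++ t ++ b) j.
Proof.
apply: (tens_ext (f := fun w : tens s n => tact a f b (pdeg x + (n + pdeg y)) j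
  (@tmid K a s b n _ x w y))
  (g := fun w : tens s n => (-1) ^ (d * pdeg x) *: tmid j x (f n (n + d) w) y))
  w => [c u v|c u v|u un].
- by rewrite tmid_linear gfun_linear.
- by rewrite gfun_linear tmid_linear scalerDr !scalerA mulrC.
- rewrite -un /tmid tlift_pure; last first.
    apply: (multilinear_catl (phi := fun v => pure _ (pcat x v))).
    exact/multilinear_catr/pure_multilinear.
  by rewrite eqxx; apply: (@tact_pure a s t b).
Qed.

Definition on1 V W (f : ghom 0 V W) : ghom 0 (tens [:: V]) (tens [:: W]) :=
  dom1 (cod1 f).

Lemma on1_pure V W (f : ghom 0 V W) i j p (v : V p) : i = p ->
  on1 f i j (@pure K [:: V] i (existT _ p v, tt)) =
  @pure K [:: W] j (existT _ p (f p p v), tt).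
Proof.
move=> ->; rewrite /= tlift_pure; last exact: dom1_val_multilinear.
by rewrite /= addr0 eqxx /dom1_val /= /cod1_fun addr0.
Qed.

Lemma tact_on1_ext a V b t0 i j (f g : tens (a ++ V :: b) i -> tens t0 j) :
  linear f -> linear g ->
  (forall (x : ptens a) p (v : V p) (y : ptens b), i = pdeg x + (p + pdeg y) ->
     f (@pure K (a ++ V :: b) i (@pcat K a (V :: b) x (existT _ p v, y))) =
     g (@pure K (a ++ V :: b) i (@pcat K a (V :: b) x (existT _ p v, y)))) ->
  f =1 g.
Proof.
move=> lf lg fg; apply: tens_ext => // z zi.
rewrite -[z]pcat_split; case: (psplit z) (pdeg_split z) => x [[p v] y] /= E.
by apply: fg; rewrite -zi -E.
Qed.

Lemma tact_on1_pure a V W b (f : ghom 0 V W) i j (x : ptens a) p (v : V p) y :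
  i = pdeg x + (p + pdeg y) ->
  tact a (on1 f) b i j
    (@pure K (a ++ V :: b) i (@pcat K a (V :: b) x (existT _ p v, y)))
  = @pure K (a ++ W :: b) j (@pcat K a (W :: b) x (existT _ p (f p p v), y))
  :> tens (a ++ W :: b) j.
Proof.
move=> E; have := @tact_pure a [:: V] [:: W] b 0 (on1 f) i j p p x
  (existT _ p v, tt) y (addr0 p) (esym (addr0 p)) E.
rewrite mul0r expr0z scale1r on1_pure // /tmid tlift_pure; last first.
  apply: (multilinear_catl (phi := fun v => pure _ (pcat x v))).
  exact/multilinear_catr/pure_multilinear.
by rewrite /= addr0 eqxx.
Qed.

Lemma tact_on1_id a V b i (x : tens (a ++ V :: b) i) :
  tact a (on1 (gid V)) b i i x = x.
Proof.
pose T : tens (a ++ V :: b) i -> tens (a ++ V :: b) i :=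
  tact a (on1 (gid V)) b i i.
apply: (@tact_on1_ext a V b _ i i T id) x => //; first exact: gfun_linear.
by move=> x p v y E; rewrite /T tact_on1_pure // gid_id.
Qed.

Lemma tact_on1_comp a V W X b (g : ghom 0 W X) (f : ghom 0 V W) i j
    (x : tens (a ++ V :: b) i) :
  tact a (on1 (gcomp0 g f)) b i j x =
  tact a (on1 g) b i j (tact a (on1 f) b i i x : tens (a ++ W :: b) i)
  :> tens (a ++ X :: b) j.
Proof.
pose T : tens (a ++ V :: b) i -> tens (a ++ X :: b) j :=
  tact a (on1 (gcomp0 g f)) b i j.
pose U : tens (a ++ V :: b) i -> tens (a ++ X :: b) j := fun x =>
  tact a (on1 g) b i j (tact a (on1 f) b i i x : tens (a ++ W :: b) i).
apply: (@tact_on1_ext a V b _ i j T U) x; first exact: gfun_linear.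
  by move=> c u v; rewrite /U !gfun_linear.
by move=> x p v y E; rewrite /T /U !tact_on1_pure.
Qed.

Lemma ihom_post_id V W i (phi : ihom V W i) : ihom_post V (gid W) i i phi = phi.
Proof.
apply: ghom_ext => a b x /=; rewrite /ihom_post_val addr0 eqxx.
have [->|ba] := eqVneq b (a + i); first exact: gid_id.
by rewrite [LHS]gfun_deg ?[RHS]gfun_deg ?addr0.
Qed.

Lemma ihom_post_comp V W X Y (g : ghom 0 X Y) (f : ghom 0 W X) i j
    (phi : ihom V W i) :
  ihom_post V (gcomp0 g f) i j phi = ihom_post V g i j (ihom_post V f i i phi).
Proof.
apply: ghom_ext => a b x /=; rewrite /ihom_post_val /= /ihom_post_val addr0 eqxx.
by [].
Qed.
End Functoriality.

Section ContramoduleCategory.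
Variables (K : fieldType) (C : coalgebra K).
Implicit Types M : contramodule C.

Definition contra_compat M M' (f : ghom 0 (con_space M) (con_space M')) : Prop :=
  forall k, (0 < k)%N ->
    gcomp f (con_t M k) =g
    gcomp (con_t M' k) (ihom_post (tens (nseq k.-1 (coal_space C))) f).

Record contra_mor M M' := ContraMor {
  contra_fun :> ghom 0 (con_space M) (con_space M');
  contra_funP : contra_compat contra_fun }.

Lemma contra_mor_ext M M' (f g : contra_mor M M') :
  contra_fun f = contra_fun g -> f = g.
Proof.
case: f g => [f fP] [g gP] /= E; case: _ / E gP => gP.
by congr ContraMor; apply: Prop_irrelevance.
Qed.

Fact contra_id_compat M : contra_compat (gid (con_space M)).
Proof.
move=> k k0 i j x; rewrite gcompE ihom_post_id /= /gcomp_fun.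
have [->|ji] := eqVneq j (i + (2 - k%:Z)); first exact: gid_id.
by rewrite gid_deg ?addr0 // gfun_deg.
Qed.

Fact contra_comp_compat M1 M2 M3 (g : contra_mor M2 M3) (f : contra_mor M1 M2) :
  contra_compat (gcomp0 g f).
Proof.
move=> k k0 i j x; rewrite gcompE ihom_post_comp.
have := contra_funP g k0 j (ihom_post _ f i i x); rewrite gcompE => <-.
have := contra_funP f k0 (i + (2 - k%:Z)) x; rewrite gcompE /= /gcomp_fun.
by rewrite /gcomp0_fun => ->.
Qed.

Definition contra_id M : contra_mor M M := ContraMor (@contra_id_compat M).
Definition contra_comp M1 M2 M3 (g : contra_mor M2 M3) (f : contra_mor M1 M2) :
  contra_mor M1 M3 := ContraMor (contra_comp_compat g f).

Definition contra_cat : category.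
Proof.
refine (@Category (contramodule C) contra_mor contra_id contra_comp _ _ _).
- by move=> A B f; apply/contra_mor_ext/gcomp0_id.
- by move=> A B f; apply/contra_mor_ext/gcomp_id.
- by move=> M1 M2 M3 M4 f g h; apply/contra_mor_ext/ghom_ext.
Defined.
End ContramoduleCategory.

Section ComoduleCategory.
Variables (K : fieldType) (D : coalgebra K).
Implicit Types P : rcomodule D.

Definition rcom_compat P P' (f : ghom 0 (rcom_space P) (rcom_space P')) : Prop :=
  forall k, (0 < k)%N ->
    gcomp (tact [::] (on1 f) (nseq k.-1 (coal_space D))) (rcom_w P k) =g
    gcomp (rcom_w P' k) f.

Record rcom_mor P P' := RComMor {
  rcom_fun :> ghom 0 (rcom_space P) (rcom_space P');
  rcom_funP : rcom_compat rcom_fun }.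

Lemma rcom_mor_ext P P' (f g : rcom_mor P P') :
  rcom_fun f = rcom_fun g -> f = g.
Proof.
case: f g => [f fP] [g gP] /= E; case: _ / E gP => gP.
by congr RComMor; apply: Prop_irrelevance.
Qed.

Fact rcom_id_compat P : rcom_compat (gid (rcom_space P)).
Proof.
move=> k k0 i j x; rewrite gcompE gid_id /gcomp -[LHS]/(gfun _ _ _).
have [->|ji] := eqVneq j (i + (2 - k%:Z)).
  exact: (@tact_on1_id K [::]).
by rewrite [LHS]gfun_deg ?[RHS]gfun_deg ?addr0.
Qed.

Fact rcom_comp_compat P1 P2 P3 (g : rcom_mor P2 P3) (f : rcom_mor P1 P2) :
  rcom_compat (gcomp0 g f).
Proof.
move=> k k0 i j x; rewrite gcompE.
have := rcom_funP g k0 j (f i i x); rewrite gcompE => <-.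
rewrite [RHS]gcomp_val; have := rcom_funP f k0 (i + (2 - k%:Z)) x; rewrite gcompE => <-.
exact: (@tact_on1_comp K [::]).
Qed.

Definition rcom_id P : rcom_mor P P := RComMor (@rcom_id_compat P).
Definition rcom_comp P1 P2 P3 (g : rcom_mor P2 P3) (f : rcom_mor P1 P2) :
  rcom_mor P1 P3 := RComMor (rcom_comp_compat g f).

Definition rcom_cat : category.
Proof.
refine (@Category (rcomodule D) rcom_mor rcom_id rcom_comp _ _ _).
- by move=> A B f; apply/rcom_mor_ext/gcomp0_id.
- by move=> A B f; apply/rcom_mor_ext/gcomp_id.
- by move=> P1 P2 P3 P4 f g h; apply/rcom_mor_ext/ghom_ext.
Defined.
End ComoduleCategory.

Section Contratensor.
Variables (K : fieldType) (C D : coalgebra K) (M : contramodule C).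
Variable N : cdspace C D.
Let MN := [:: con_space M; cd_space N].

(* The k-th components of the two maps whose coequalizer is M [x]_C N. *)
Definition contratensor_ev k :
    ghom (2 - k%:Z + 0)
      (tens [:: ihom (tens (nseq k.-1 (coal_space C))) (con_space M); cd_space N])
      (tens MN) :=
  gcomp
    (tact [::] (cod1 (ev (nseq k.-1 (coal_space C)) (con_space M)))
          [:: cd_space N]
       : ghom 0 (tens (ihom (tens (nseq k.-1 (coal_space C))) (con_space M) ::
                       nseq k.-1 (coal_space C) ++ [:: cd_space N])) _)
    (tact [:: ihom (tens (nseq k.-1 (coal_space C))) (con_space M)]
          (dom1 (cd_wL N k)) [::]).

Definition contratensor_t k :
    ghom (2 - k%:Z)
      (tens [:: ihom (tens (nseq k.-1 (coal_space C))) (con_space M); cd_space N])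
      (tens MN) :=
  tact [::] (dom1 (cod1 (con_t M k))) [:: cd_space N].

(* A map out of a direct sum over k >= 1 is the family of its components, so  *)
(* f coequalizes the two maps from the direct sum when it coequalizes the     *)
(* k-th components for all k >= 1.                                            *)
Definition coequalizes (X : gspace K) (f : ghom 0 (tens MN) X) : Prop :=
  forall k, (0 < k)%N ->
    gcomp f (contratensor_ev k) =g gcomp f (contratensor_t k).

Definition is_contratensor (Q : gspace K) (pi : ghom 0 (tens MN) Q) : Prop :=
  coequalizes pi /\
  forall (X : gspace K) (f : ghom 0 (tens MN) X), coequalizes f ->
    exists! g : ghom 0 Q X, gcomp0 g pi = f.

(* The comodule structure of P is the one induced along pi by M (x) w^R.      *)
Definition induced_comodule (P : rcomodule D)
    (pi : ghom 0 (tens MN) (rcom_space P)) : Prop :=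
  forall l, (0 < l)%N ->
    gcomp (rcom_w P l) pi =g
    gcomp (tact [::] (cod1 pi) (nseq l.-1 (coal_space D))
             : ghom 0 (tens (MN ++ nseq l.-1 (coal_space D))) _)
          (tact [:: con_space M] (dom1 (cd_wR N l)) [::]).
End Contratensor.

(* F sends M to its contratensor product with N, and f to the map induced by  *)
(* f (x) N on the quotients.                                                  *)
Definition is_contratensor_functor (K : fieldType) (C D : coalgebra K)
    (N : cdspace C D) (F : functor (contra_cat C) (rcom_cat D)) : Prop :=
  exists pi : forall M : contramodule C,
      ghom 0 (tens [:: con_space M; cd_space N]) (rcom_space (F M)),
    [/\ forall M, is_contratensor (pi M),
        forall M, induced_comodule (pi M)
      & forall (M M' : contramodule C) (f : contra_mor M M'),
          gcomp0 (fmap F f : rcom_mor _ _) (pi M) =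
          gcomp0 (pi M') (tact [::] (on1 f) [:: cd_space N])].

(* Main.v *)
From HB Require Import structures.
Require Import Defs.
From mathcomp Require Import all_boot all_order all_algebra.
From mathcomp Require Import generic_quotient boolp zify.

(* M [x]_C N is the quotient of M (x) N by the relations                      *)
(* ev (phi (x) w^L_k n) ~ t_k phi (x) n. To see that M (x) w^R_l descends to  *)
(* it, apply w^R_l to the left-hand side: as the coactions commute, it can be *)
(* moved past w^L_k and ev, and the relation is then used on each term        *)
(* n' (x) d of w^R_l n. The Koszul sign picked up is (-1)^(l k), which is     *)
(* trivial because w^R_l vanishes for odd l. On the class of m (x) n every    *)
(* term of the n-th comodule relation is the image of the corresponding term  *)
(* for N under m (x) -, up to the common sign (-1)^((3 - n)|m|), so the       *)
(* relation for N implies the one for the quotient.                           *)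

Set Implicit Arguments.
Unset Strict Implicit.
Unset Printing Implicit Defensive.

Import Order.TTheory GRing.Theory Num.Theory.
Local Open Scope ring_scope.
Local Open Scope quotient_scope.

(** The product [ct_space] is, in each degree, the quotient of M (x) N by ev (phi (x) w^L_k n) ~ t_k
    phi (x) n. A map on it is a map on M (x) N respecting these relations ([ct_lift]), and two maps
    that agree after [ct_proj] are equal ([ct_proj_epi]). So every structure is obtained by descent,
    and every identity is tested on classes of pure tensors m (x) n.

    The coaction descends by [coaction_coequalizes]. [tact_evalat] moves w^R_l past the evaluation
    of phi, commutation exchanges w^R_l and w^L_k, and [tact_cod1_evalat] applies the relation to
    the N-factor of each term of w^R_l n while the D-factors stay fixed. Evenness of w^R removes the
    signs of w^R_l; the signs of w^L_k cancel in pairs.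

    For the comodule relations [ct_relP], fix m and let [slice] send y to (pi (x) 1)(m (x) y). By
    [ct_term_tail] and [ct_term_head], a composite of structure maps on the class of m (x) n is the
    slice of the same composite for N, up to a sign depending only on its total degree. All terms of
    one relation have the same total degree, so the relation for N carries over.

    A contramodule morphism f induces f (x) N, which respects the relations because f commutes with
    evaluation and with t_k ([ct_premap_coequalizes]); it commutes with the coaction because the
    latter acts on N alone ([ct_map_compat]). *)

(** * Linear maps and quotients of modules and graded spaces *)

Section LinearProp.
Variables (K : fieldType) (V W : lmodType K) (f : V -> W).
Hypothesis lf : linear f.

Lemma lin_add u v : f (u + v) = f u + f v.
Proof. by have := lf 1 u v; rewrite !scale1r. Qed.

Lemma lin0 : f 0 = 0.
Proof. by apply: (addrI (f 0)); rewrite -lin_add !addr0. Qed.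

Lemma lin_scale a u : f (a *: u) = a *: f u.
Proof. by have := lf a u 0; rewrite !addr0 lin0 addr0. Qed.

Lemma lin_sum I (r : seq I) (P : pred I) (F : I -> V) :
  f (\sum_(i <- r | P i) F i) = \sum_(i <- r | P i) f (F i).
Proof. exact: (big_morph f lin_add lin0). Qed.
End LinearProp.

(* The quotient by the submodule generated by the differences [u - v] with    *)
(* [R u v], realized by identifying the vectors that no linear map            *)
(* compatible with [R] separates.                                             *)
Section ModuleQuotient.
Variables (K : fieldType) (V : lmodType K) (R : V -> V -> Prop).

Definition compatible (Z : lmodType K) (f : V -> Z) : Prop :=
  linear f /\ forall u v, R u v -> f u = f v.

Definition mquot_equiv : rel V := fun u v =>
  `[< forall (Z : lmodType K) (f : V -> Z), compatible f -> f u = f v >].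

Fact mquot_equiv_refl : reflexive mquot_equiv.
Proof. by move=> u; apply/asboolP. Qed.
Fact mquot_equiv_sym : symmetric mquot_equiv.
Proof. by move=> u v; apply/asboolP/asboolP => H Z f cf; rewrite H. Qed.
Fact mquot_equiv_trans : transitive mquot_equiv.
Proof.
move=> v u w /asboolP H /asboolP H'.
by apply/asboolP => Z f cf; rewrite H // H'.
Qed.
Canonical mquot_equiv_rel :=
  EquivRel mquot_equiv mquot_equiv_refl mquot_equiv_sym mquot_equiv_trans.

Definition mquot := {eq_quot mquot_equiv_rel}.
HB.instance Definition _ := Choice.on mquot.

Definition mproj (u : V) : mquot := \pi_mquot u.
Definition mlift (Z : lmodType K) (f : V -> Z) (x : mquot) : Z := f (repr x).

Lemma mlift_proj (Z : lmodType K) (f : V -> Z) u :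
  compatible f -> mlift f (mproj u) = f u.
Proof.
by move=> cf; rewrite /mlift /mproj; case: piP => v /eqquotP /asboolP ->.
Qed.

Lemma mproj_eq u v :
  (forall (Z : lmodType K) (f : V -> Z), compatible f -> f u = f v) ->
  mproj u = mproj v.
Proof. by move=> H; apply/eqquotP/asboolP. Qed.

Lemma mproj_repr (x : mquot) : mproj (repr x) = x.
Proof. exact: reprK. Qed.

Lemma mproj_rel u v : R u v -> mproj u = mproj v.
Proof. by move=> Ruv; apply: mproj_eq => Z f [_]; apply. Qed.

Definition mquot_add (x y : mquot) := mproj (repr x + repr y).
Definition mquot_opp (x : mquot) := mproj (- repr x).
Definition mquot_scale a (x : mquot) := mproj (a *: repr x).

Lemma mquot_addE u v : mquot_add (mproj u) (mproj v) = mproj (u + v).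
Proof.
apply: mproj_eq => Z f cf; have [lf _] := cf.
by rewrite !(lin_add lf) -!/(mlift f _) !mlift_proj.
Qed.

Lemma mquot_scaleE a u : mquot_scale a (mproj u) = mproj (a *: u).
Proof.
apply: mproj_eq => Z f cf; have [lf _] := cf.
by rewrite !(lin_scale lf) -!/(mlift f _) !mlift_proj.
Qed.

Lemma mquot_oppE u : mquot_opp (mproj u) = mproj (- u).
Proof. by rewrite -scaleN1r -mquot_scaleE /mquot_scale scaleN1r. Qed.

Fact mquot_addA : associative mquot_add.
Proof.
move=> x y z; rewrite -[x]mproj_repr -[y]mproj_repr -[z]mproj_repr.
by rewrite !mquot_addE addrA.
Qed.
Fact mquot_addC : commutative mquot_add.
Proof. by move=> x y; rewrite /mquot_add addrC. Qed.
Fact mquot_add0 : left_id (mproj 0) mquot_add.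
Proof. by move=> x; rewrite -[x]mproj_repr mquot_addE add0r. Qed.
Fact mquot_addN : left_inverse (mproj 0) mquot_opp mquot_add.
Proof. by move=> x; rewrite -[x]mproj_repr mquot_oppE mquot_addE addNr. Qed.
HB.instance Definition _ :=
  GRing.isZmodule.Build mquot mquot_addA mquot_addC mquot_add0 mquot_addN.

Lemma mprojD u v : mproj (u + v) = mproj u + mproj v.
Proof. exact: esym (mquot_addE u v). Qed.

Fact mquot_scaleA a b x :
  mquot_scale a (mquot_scale b x) = mquot_scale (a * b) x.
Proof. by rewrite -[x]mproj_repr !mquot_scaleE scalerA. Qed.
Fact mquot_scale1 : left_id 1 mquot_scale.
Proof. by move=> x; rewrite -[x]mproj_repr mquot_scaleE scale1r. Qed.
Fact mquot_scaleDr : right_distributive mquot_scale +%R.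
Proof.
move=> a x y; rewrite -[x]mproj_repr -[y]mproj_repr.
by rewrite -mprojD !mquot_scaleE -mprojD scalerDr.
Qed.
Fact mquot_scaleDl x : {morph mquot_scale^~ x : a b / a + b}.
Proof.
by move=> a b; rewrite -[x]mproj_repr !mquot_scaleE -mprojD scalerDl.
Qed.
HB.instance Definition _ := GRing.Zmodule_isLmodule.Build K mquot
  mquot_scaleA mquot_scale1 mquot_scaleDr mquot_scaleDl.

Lemma mproj_linear : linear mproj.
Proof.
move=> a u v; rewrite mprojD; congr (_ + _).
exact: esym (mquot_scaleE a u).
Qed.

Lemma mlift_linear (Z : lmodType K) (f : V -> Z) :
  compatible f -> linear (mlift f).
Proof.
move=> cf a x y; rewrite -[x]mproj_repr -[y]mproj_repr -mproj_linear.
by rewrite !mlift_proj //; case: cf => lf _; apply: lf.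
Qed.
End ModuleQuotient.

Section GradedQuotient.
Variables (K : fieldType) (V : gspace K).
Variable R : forall i, V i -> V i -> Prop.

Definition gquot : gspace K := fun i => mquot (@R i).

(** Passing through [gid] makes the projection vanish off the diagonal i = j, as a degree-0 [ghom]
    must. *)
Definition gproj_fun i j (x : V i) : gquot j := mproj (@R j) (gid V i j x).

Fact gproj_linear i j : linear (@gproj_fun i j).
Proof. by move=> a u v; rewrite /gproj_fun linearP mproj_linear. Qed.

Fact gproj_deg i j (x : V i) : j != i + 0 -> gproj_fun j x = 0.
Proof.
by move=> ji; rewrite /gproj_fun gfun_deg // (lin0 (@mproj_linear _ _ _)).
Qed.

Definition gproj : ghom 0 V gquot := GHom gproj_linear gproj_deg.

Lemma gprojE i (x : V i) : gproj i i x = mproj (@R i) x.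
Proof. by rewrite /= /gproj_fun gid_id. Qed.

(** Surjectivity of the projection, phrased as an induction principle. *)
Lemma gproj_ind i (P : gquot i -> Prop) :
  (forall x, P (gproj i i x)) -> forall q, P q.
Proof. by move=> h q; have := h (repr q); rewrite gprojE mproj_repr. Qed.

Section Lift.
Variables (d : int) (X : gspace K) (f : ghom d V X).
Hypothesis cf : forall i j u v, R u v -> f i j u = f i j v.

Let compat i j : compatible (@R i) (f i j).
Proof. by split=> [|u v]; [apply: gfun_linear | apply: cf]. Qed.

Fact glift_deg i j (x : gquot i) : j != i + d -> mlift (f i j) x = 0.
Proof. exact: gfun_deg. Qed.

Definition glift : ghom d gquot X :=
  GHom (fun i j => mlift_linear (compat i j)) glift_deg.

Lemma gliftE i j x : glift i j (gproj i i x) = f i j x.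
Proof. by rewrite gprojE /= mlift_proj. Qed.
End Lift.
End GradedQuotient.

(** * Koszul signs *)

Section Signs.
Variable K : fieldType.

Lemma signD (a b : int) : (-1) ^ (a + b) = (-1) ^ a * (-1) ^ b :> K.
Proof. by rewrite expfzDr // oppr_eq0 oner_eq0. Qed.

Lemma sign_neq0 (a : int) : (-1) ^ a != 0 :> K.
Proof. by rewrite expfz_neq0 // oppr_eq0 oner_eq0. Qed.

Lemma sign_sqr (a : int) : (-1) ^ a * (-1) ^ a = 1 :> K.
Proof. by rewrite -expfzMl mulrNN mulr1 exp1rz. Qed.

(** This is how evenness enters: a structure map of even index n has even degree 2 - n, so moving it
    past anything costs no sign. *)
Lemma sign_even n (a : int) : ~~ odd n -> (-1) ^ ((2 - n%:Z) * a) = 1 :> K.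
Proof.
move=> en; have -> : 2 - n%:Z = (1 - (n./2)%:Z) * 2.
  by rewrite mulrBl mul1r -{1}[n]even_halfK // -muln2 PoszM.
by rewrite -mulrA [2 * a]mulrDl !mul1r mulrDr signD sign_sqr.
Qed.
End Signs.

(** * Maps acting on factors of pure tensors *)

Section Casts.
Variable K : fieldType.
Implicit Types (s t : seq (gspace K)).

(* Lists such as s ++ [::] and s, or (s ++ t) ++ u and s ++ (t ++ u), are only *)
(* provably equal, so pure tensors over them are compared through a cast.     *)
Definition pcast s t (e : s = t) (x : ptens s) : ptens t := ecast u (ptens u) e x.

Lemma pcast_id s (e : s = s) x : pcast e x = x.
Proof. by rewrite (Prop_irrelevance e erefl). Qed.

Lemma pcast_cons V s t (e : s = t) (e' : V :: s = V :: t) v x :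
  pcast e' ((v, x) : ptens (V :: s)) = (v, pcast e x).
Proof. by case: _ / e e' => e'; rewrite pcast_id. Qed.

Lemma pcast_cats0 s (e : s ++ [::] = s) (x : ptens s) :
  pcast e (pcat x (tt : ptens [::])) = x.
Proof.
elim: s e x => [|V s IHs] e x; first by rewrite pcast_id; case: x.
by case: x => v x /=; rewrite (@pcast_cons V _ _ (cats0 s)) IHs.
Qed.

Lemma pcast_catA s t u (e : (s ++ t) ++ u = s ++ (t ++ u))
    (x : ptens s) (y : ptens t) (z : ptens u) :
  pcast e (pcat (pcat x y) z) = pcat x (pcat y z).
Proof.
elim: s e x => [|V s IHs] e x; first by rewrite pcast_id.
by case: x => v x /=; rewrite (@pcast_cons V _ _ (esym (catA s t u))) IHs.
Qed.

Lemma eq_tlift s n (Z : lmodType K) (phi psi : ptens s -> Z) (x : tens s n) :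
  (forall u, pdeg u = n -> phi u = psi u) -> tlift phi x = tlift psi x.
Proof.
move=> h; rewrite /tlift /feval; apply: eq_bigr => u /eqP un.
by rewrite h.
Qed.

Lemma tlift_comp s n (Z Z' : lmodType K) (g : Z -> Z') (phi : ptens s -> Z)
    (x : tens s n) :
  linear g -> g (tlift phi x) = tlift (fun u => g (phi u)) x.
Proof.
move=> lg; rewrite /tlift /feval (lin_sum lg).
by apply: eq_bigr => u _; rewrite (lin_scale lg).
Qed.

(** Extends [tact_pure] to source and target lists that are only provably equal to the expected
    concatenations. *)
Lemma tact_pureE a s t b d (f : ghom d (tens s) (tens t)) s0 t0
    (es : a ++ s ++ b = s0) (et : a ++ t ++ b = t0) i j
    (x : ptens a) (u : ptens s) (y : ptens b) :
  pdeg x + (pdeg u + pdeg y) = i ->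
  tact a f b i j (pure i (pcast es (pcat x (pcat u y))) : tens s0 i) =
  (-1) ^ (d * pdeg x) *:
    tlift (fun v => pure j (pcast et (pcat x (pcat v y))))
          (f (pdeg u) (pdeg u + d) (pure (pdeg u) u)) :> tens t0 j.
Proof.
case: _ / es; case: _ / et => <-.
by rewrite (@tact_pure K a s t b d f _ j _ _ x u y erefl erefl erefl).
Qed.

Lemma tact0 a s t b d s0 t0 i j (x : tens s0 i) :
  tact a (0 : ghom d (tens s) (tens t)) b i j x = 0 :> tens t0 j.
Proof.
rewrite /= /tact_fun tlift_eq0 ?tcast0 // => u _.
by rewrite /tact_val /= (lin0 (@tmid_linear _ _ _ _ _ _ _ _)) scaler0.
Qed.

Lemma dom10 d (V W : gspace K) : dom1 (0 : ghom d V W) = 0.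
Proof. by apply: ghom_ext => i j x /=; apply: tlift_eq0. Qed.
End Casts.

Section LastFactor.
Variable K : fieldType.
Implicit Types (a s t : seq (gspace K)).

Lemma pcast_cats0r a t (e : a ++ (t ++ [::]) = a ++ t) (x : ptens a) (v : ptens t) :
  pcast e (pcat x (pcat v (tt : ptens [::]))) = pcat x v.
Proof.
elim: a e x => [|V a IHa] e x; first exact: pcast_cats0.
by case: x => v0 x /=; rewrite (@pcast_cons K V _ _ (congr1 (cat a) (cats0 t))) IHa.
Qed.

Lemma tact_pure_last a s t d (f : ghom d (tens s) (tens t)) i j
    (x : ptens a) (u : ptens s) :
  pdeg x + pdeg u = i ->
  tact a f [::] i j (pure i (pcat x u) : tens (a ++ s) i) =
  (-1) ^ (d * pdeg x) *:
    tlift (fun v => pure j (pcat x v)) (f (pdeg u) (pdeg u + d) (pure (pdeg u) u))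
  :> tens (a ++ t) j.
Proof.
move=> E; pose es := congr1 (cat a) (cats0 s); pose et := congr1 (cat a) (cats0 t).
rewrite -(pcast_cats0r es) (@tact_pureE K a s t [::] d f _ _ es et) ?addr0 //.
by congr (_ *: _); apply: eq_tlift => v _; rewrite pcast_cats0r.
Qed.

Lemma dom1_pure d (V W : gspace K) (f : ghom d V W) i j p (v : V p) : p = i ->
  dom1 f i j (pure i ((existT _ p v, tt) : ptens [:: V])) = f p j v.
Proof.
move=> <-; rewrite /= tlift_pure; last exact: dom1_val_multilinear.
by rewrite /= addr0 eqxx.
Qed.

Lemma tact_last_pure a t d (V : gspace K) (f : ghom d V (tens t)) i j
    (x : ptens a) p (v : V p) :
  pdeg x + p = i ->
  tact a (dom1 f) [::] i j
    (pure i (pcat x ((existT _ p v, tt) : ptens [:: V])) : tens (a ++ [:: V]) i) =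
  (-1) ^ (d * pdeg x) *: tlift (fun w => pure j (pcat x w)) (f p (p + d) v)
  :> tens (a ++ t) j.
Proof.
have E0 : pdeg ((existT _ p v, tt) : ptens [:: V]) = p by rewrite /= addr0.
by move=> E; rewrite tact_pure_last E0 // dom1_pure.
Qed.

Lemma tact_head_pure t b d (V : gspace K) (f : ghom d V (tens t)) t0
    (et : t ++ b = t0) i j p (v : V p) (y : ptens b) :
  p + pdeg y = i ->
  tact [::] (dom1 f) b i j (pure i ((existT _ p v, y) : ptens (V :: b))) =
  tlift (fun w => pure j (pcast et (pcat w y))) (f p (p + d) v) :> tens t0 j.
Proof.
have E0 : pdeg ((existT _ p v, tt) : ptens [:: V]) = p by rewrite /= addr0.
move=> E; have := @tact_pureE K [::] [:: V] t b d (dom1 f) _ _ erefl et i j tt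
  (existT _ p v, tt) y.
rewrite E0 [@pdeg K [::] tt + _]add0r => -> //.
by rewrite [@pdeg K [::] tt]/(0 : int) mulr0 expr0z scale1r dom1_pure.
Qed.

(** Used from right to left, it expands a tensor into pure ones, so that two linear images of it can
    be compared termwise by [eq_tlift]. *)
Lemma tlift_pure_id s n (x : tens s n) : tlift (@pure K s n) x = x.
Proof.
have lp : linear (fun x : tens s n => tlift (@pure K s n) x).
  exact: tlift_linear (@pure_multilinear K s n).
apply: (tens_ext (g := id) lp) => // z zn.
by rewrite tlift_pure ?zn ?eqxx //; apply: pure_multilinear.
Qed.

Lemma head_pure_linear (V : gspace K) s j k (y : ptens s) :
  linear (fun v : V k => pure j ((existT _ k v, y) : ptens (V :: s))).
Proof. by have [h _] := @pure_multilinear K (V :: s) j; apply: h. Qed.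

Lemma cons_pure_multilinear (V : gspace K) s j (v : {p : int & V p}) :
  multilinear (fun u : ptens s => pure j ((v, u) : ptens (V :: s))).
Proof. by have [_ h] := @pure_multilinear K (V :: s) j; apply: h. Qed.

Lemma rcons_pure_multilinear s t j (y : ptens t) :
  multilinear (fun u : ptens s => pure j (pcat u y)).
Proof. exact/multilinear_catl/pure_multilinear. Qed.
End LastFactor.

(** * Applying f to the leading factors, with m in M fixed *)

Section Apply.
Variables (K : fieldType) (s : seq (gspace K)) (Q : gspace K).
Variable f : ghom 0 (tens s) Q.

(* The value of f at a pure tensor, as a factor of a pure tensor.             *)
Definition papp (u : ptens s) : {p : int & Q p} :=
  existT _ (pdeg u) (f (pdeg u) (pdeg u) (pure (pdeg u) u)).

(** Packing the degree with the value lets degrees that are equal but not convertible be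
    identified. *)
Lemma pappE (u : ptens s) i j : pdeg u = i -> i = j ->
  existT _ j (f i j (pure i u)) = papp u.
Proof. by move=> <- <-. Qed.

Lemma tact_cod1_pure b i j (u : ptens s) (y : ptens b) :
  pdeg u + pdeg y = i ->
  tact [::] (cod1 f) b i j (pure i (pcat u y) : tens (s ++ b) i) =
  pure j ((papp u, y) : ptens (Q :: b)) :> tens (Q :: b) j.
Proof.
move=> E; have := @tact_pureE K [::] s [:: Q] b 0 (cod1 f) _ _ erefl erefl i j
  tt u y; rewrite /= add0r => -> //.
rewrite mul0r expr0z scale1r /cod1_fun tlift_pure; last first.
  apply: (multilinear_catl (s := [:: Q])
    (phi := fun v : ptens ([:: Q] ++ b) => pure j v)); exact: pure_multilinear.
by rewrite /= addr0 eqxx; congr pure; congr pair; apply: pappE; rewrite ?addr0.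
Qed.
End Apply.

Section Slice.
Variables (K : fieldType) (M N Q : gspace K).
Variable f : ghom 0 (tens [:: M; N]) Q.
Variables (e : int) (m : M e).

Definition slice_val b j (z : ptens (N :: b)) : tens (Q :: b) j :=
  pure j ((papp f (existT _ e m, (z.1, tt)), z.2) : ptens (Q :: b)).

Lemma slice_val_multilinear b j : multilinear (@slice_val b j).
Proof.
have [h1 h2] := @pure_multilinear K (Q :: b) j.
split=> [p y c u v|v]; last exact: (h2 (papp f (existT _ e m, (v, tt)))).
rewrite /slice_val /papp /=; set i := e + (p + 0).
have -> : pure i ((existT _ e m, (existT _ p (c *: u + v), tt)) : ptens [:: M; N])
  = c *: pure i ((existT _ e m, (existT _ p u, tt)) : ptens [:: M; N])
    + pure i ((existT _ e m, (existT _ p v, tt)) : ptens [:: M; N]).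
  exact: (proj1 (proj2 (@pure_multilinear _ [:: M; N] i) (existT _ e m))).
by rewrite linearP h1.
Qed.

(* The map y |-> (f (x) 1) (m (x) y).                                         *)
Definition slice b i j (y : tens (N :: b) i) : tens (Q :: b) j :=
  tlift (@slice_val b j) y.

Lemma slice_linear b i j : linear (@slice b i j).
Proof. exact/tlift_linear/slice_val_multilinear. Qed.

Lemma slice_pure b i j (z : ptens (N :: b)) : j = e + i ->
  slice j (pure i z) = slice_val j z.
Proof.
move=> ->; rewrite /slice tlift_pure; last exact: slice_val_multilinear.
(* If z is not of degree i, the left side is already 0, and the pure tensor on the right has a
   degree other than j. *)
case: eqP => // /eqP zi; rewrite /slice_val pure_deg //=.
by apply: contra zi; rewrite addr0 -addrA => /eqP/addrI E; apply/eqP.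
Qed.

Lemma tact_cod1_slice b i j n (w : tens (N :: b) n) : i = e + n ->
  tact [::] (cod1 f) b i j
    (tlift (fun u : ptens (N :: b) =>
       pure i ((existT _ e m, u) : ptens (M :: N :: b))) w) =
  slice j w :> tens (Q :: b) j.
Proof.
move=> ->; rewrite (tlift_comp _ _ (@gfun_linear _ _ _ _ _ _ _)).
apply: eq_tlift => -[n' y] /= <-.
have E : pdeg ((existT _ e m, (n', tt)) : ptens [:: M; N]) + pdeg y =
  e + (tag n' + pdeg y) by rewrite /= addr0 addrA.
exact: (tact_cod1_pure f j E).
Qed.

(** The prefix left of g has degree larger by e in the target than in the source, which accounts for
    the sign (-1)^(d e). *)
Lemma slice_tact_tail a s t b d (g : ghom d (tens s) (tens t)) s0 t0
    (es : a ++ s ++ b = s0) (et : a ++ t ++ b = t0) n n' j j'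
    (y : tens (N :: s0) n) : j = e + n -> j' = e + n' ->
  tact (Q :: a) g b j j' (slice j y : tens (Q :: s0) j) =
  (-1) ^ (d * e) *: slice j' (tact (N :: a) g b n n' y : tens (N :: t0) n')
  :> tens (Q :: t0) j'.
Proof.
case: _ / es y; case: _ / et => y -> Ej; apply: (scalerI (sign_neq0 K (d * e))).
rewrite scalerA sign_sqr scale1r; symmetry.
pose F (y : tens (N :: (a ++ s ++ b)) n) : tens (Q :: (a ++ t ++ b)) j' :=
  slice j' (tact (N :: a) g b n n' y : tens (N :: (a ++ t ++ b)) n').
pose G (y : tens (N :: (a ++ s ++ b)) n) : tens (Q :: (a ++ t ++ b)) j' :=
  (-1) ^ (d * e) *: tact (Q :: a) g b (e + n) j'
    (slice (e + n) y : tens (Q :: (a ++ s ++ b)) (e + n)).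
apply: (tens_ext (f := F) (g := G)) y.
- by move=> c u v; rewrite /F gfun_linear slice_linear.
- move=> c u v; rewrite /G slice_linear gfun_linear scalerDr !scalerA.
  by rewrite [_ * c]mulrC.
rewrite /F /G => -[p z]; rewrite -[z]pcat_split -(pcat_split (psplit z).2).
case: (psplit z) => x uy /=; case: (psplit uy) => u yb /= <-.
rewrite slice_pure // /slice_val /=.
set q := papp f _.
have := @tact_pureE K (N :: a) s t b d g _ _ erefl erefl
  (tag p + pdeg (pcat x (pcat u yb))) n' (p, x) u yb.
rewrite /= => ->; last by rewrite !pdeg_cat !addrA.
have := @tact_pureE K (Q :: a) s t b d g _ _ erefl erefl
  (e + (tag p + pdeg (pcat x (pcat u yb)))) j' (q, x) u yb.
rewrite /= => ->; last by rewrite addr0 !pdeg_cat !addrA.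
rewrite (lin_scale (@slice_linear _ _ _)) (tlift_comp _ _ (@slice_linear _ _ _)).
rewrite scalerA addr0 -[e + _ + _]addrA [d * (e + _)]mulrDr signD mulrA.
rewrite sign_sqr mul1r; congr (_ *: _).
by apply: eq_tlift => v _; rewrite slice_pure.
Qed.

(** The hypothesis says that [wQ] is induced by [w] on classes with first factor m; the factors in
    [b] are carried along unchanged. *)
Lemma slice_tact_head B b d (w : ghom d N (tens (N :: B)))
    (wQ : ghom d Q (tens (Q :: B))) s0 t0 (es : b = s0) (et : B ++ b = t0)
    n n' j j' (y : tens (N :: s0) n) :
    (forall p (v : N p) i j, i = e + p -> j = e + (p + d) ->
       wQ i j (f i i (pure i ((existT _ e m, (existT _ p v, tt)) : ptens [:: M; N])))
       = (-1) ^ (d * e) *: slice j (w p (p + d) v)) ->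
  j = e + n -> j' = e + n' ->
  tact [::] (dom1 wQ) b j j' (slice j y : tens (Q :: s0) j) =
  (-1) ^ (d * e) *: slice j' (tact [::] (dom1 w) b n n' y : tens (N :: t0) n')
  :> tens (Q :: t0) j'.
Proof.
case: _ / es y; case: _ / et => y H -> Ej; apply: (scalerI (sign_neq0 K (d * e))).
rewrite scalerA sign_sqr scale1r; symmetry.
pose F (y : tens (N :: b) n) : tens (Q :: (B ++ b)) j' :=
  slice j' (tact [::] (dom1 w) b n n' y : tens (N :: (B ++ b)) n').
pose G (y : tens (N :: b) n) : tens (Q :: (B ++ b)) j' :=
  (-1) ^ (d * e) *: tact [::] (dom1 wQ) b (e + n) j'
    (slice (e + n) y : tens (Q :: b) (e + n)).
apply: (tens_ext (f := F) (g := G)) y.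
- by move=> c u v; rewrite /F gfun_linear slice_linear.
- move=> c u v; rewrite /G slice_linear gfun_linear scalerDr !scalerA.
  by rewrite [_ * c]mulrC.
move=> [[p v] y] /= En; rewrite /F /G; case: _ / En.
rewrite slice_pure // /slice_val.
rewrite -(@pappE _ _ _ f _ (e + p) (e + p)) //; last by rewrite /= addr0.
rewrite (tact_head_pure w (erefl (N :: (B ++ b)))) //.
rewrite (tact_head_pure wQ (erefl (Q :: (B ++ b)))); last by rewrite addrA.
rewrite (tlift_comp _ _ (@slice_linear _ _ _)) H ?addrA //.
have mB : multilinear (fun v : ptens (Q :: B) =>
    pure j' (pcat v y : ptens (Q :: (B ++ b)))).
  apply: (multilinear_catl (s := Q :: B)
    (phi := fun z : ptens ((Q :: B) ++ b) => pure j' z)).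
  exact: pure_multilinear.
rewrite (lin_scale (tlift_linear mB)) scalerA sign_sqr scale1r.
rewrite [X in _ = tlift _ X]/slice (tlift_comp _ _ (tlift_linear mB)).
apply: eq_tlift => -[v0 v1] Ev; rewrite slice_pure // (tlift_pure _ _ mB) /=.
by rewrite addr0 -!addrA [tag v0 + _]Ev eqxx.
Qed.
End Slice.

(** * Evaluation of a fixed cochain phi *)

Section Evaluate.
Variables (K : fieldType) (s : seq (gspace K)) (M N : gspace K).
Variables (e : int) (phi : ihom (tens s) M e).
Let H := ihom (tens s) M.
Let phi' : {p : int & H p} := existT _ e phi.

(* The map y |-> (ev (x) 1) (phi (x) y).                                      *)
Definition evalat b i j (y : tens (s ++ b) i) : tens (M :: b) j :=
  tact [::] (cod1 (ev s M)) b j j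
    (tlift (fun u : ptens (s ++ b) => pure j ((phi', u) : ptens (H :: s ++ b))) y
     : tens (H :: s ++ b) j).

Lemma evalat_linear b i j : linear (@evalat b i j).
Proof.
move=> c u v; rewrite /evalat (tlift_linear (@cons_pure_multilinear K H (s ++ b) _ phi')).
by rewrite gfun_linear.
Qed.

Lemma evalat_pure b i j (c : ptens s) (y : ptens b) : j = e + i ->
  evalat j (pure i (pcat c y) : tens (s ++ b) i) =
  pure j ((papp (ev s M) ((phi', c) : ptens (H :: s)), y) : ptens (M :: b)).
Proof.
move=> ->; rewrite /evalat (tlift_pure _ _ (@cons_pure_multilinear K H (s ++ b) _ phi')).
case: eqP => [<-|/eqP ci].
  apply: (@tact_cod1_pure K (H :: s) M (ev s M) b _ _ ((phi', c) : ptens (H :: s)) y).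
  by rewrite /= pdeg_cat addrA.
rewrite linear0 pure_deg //=; apply: contra ci.
by rewrite pdeg_cat -addrA => /eqP/addrI ->.
Qed.

(** On c (x) n the value of phi has degree e + |c|. Of the sign w picks up, the part from |c| also
    occurs when w acts before evaluation; the part from e remains. *)
Lemma tact_evalat t d (w : ghom d N (tens t)) i j i' j' (z : tens (s ++ [:: N]) i) :
    j = e + i -> j' = e + i' ->
  tact [:: M] (dom1 w) [::] j j' (evalat j z) =
  (-1) ^ (d * e) *:
    evalat j' (tact s (dom1 w) [::] i i' z : tens (s ++ t) i')
  :> tens (M :: t) j'.
Proof.
move=> Ej Ej'.
pose F (z : tens (s ++ [:: N]) i) : tens (M :: t) j' :=
  tact [:: M] (dom1 w) [::] j j' (evalat j z).
pose G (z : tens (s ++ [:: N]) i) : tens (M :: t) j' :=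
  (-1) ^ (d * e) *: evalat j' (tact s (dom1 w) [::] i i' z : tens (s ++ t) i').
apply: (tens_ext (f := F) (g := G)) z.
- by move=> c u v; rewrite /F evalat_linear gfun_linear.
- move=> c u v; rewrite /G gfun_linear evalat_linear scalerDr !scalerA.
  by rewrite [_ * c]mulrC.
move=> z; rewrite -[z]pcat_split; case: (psplit z) => c [[p n] []] /= Ei.
rewrite /F /G.
rewrite evalat_pure //; set q := papp _ _.
have Eq : pdeg ((q, tt) : ptens [:: M]) = e + pdeg c by rewrite /= addr0.
have -> := @tact_last_pure K [:: M] t d N w j j' (q, tt) p n; last first.
  by rewrite Ej -Ei /= pdeg_cat /= !addr0 addrA.
rewrite tact_last_pure; last by rewrite -Ei pdeg_cat /= addr0.
rewrite Eq (lin_scale (@evalat_linear _ _ _)) scalerA -signD -mulrDr.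
congr (_ *: _); rewrite (tlift_comp _ _ (@evalat_linear _ _ _)).
by apply: eq_tlift => v _; rewrite evalat_pure.
Qed.

(** The relation ev (phi (x) w^L n) ~ m (x) n, with m in the role of t phi, extended to tensors with
    further factors [b] to the right of n. *)
Lemma tact_cod1_evalat Q (f : ghom 0 (tens [:: M; N]) Q) b d
    (wL : ghom d N (tens (s ++ [:: N]))) (m : M (e + d)) i i' j
    (y : tens (N :: b) i) :
    (forall p (n : N p) k, k = e + (p + d) ->
       f k k (pure k ((existT _ (e + d) m, (existT _ p n, tt)) : ptens [:: M; N])) =
       (-1) ^ (d * e) *: f k k (evalat k (wL p (p + d) n))) ->
    i' = i + d -> j = e + i' ->
  tact [::] (cod1 f) b j j
    (evalat j (tact [::] (dom1 wL) b i i' y : tens (s ++ N :: b) i')) =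
  (-1) ^ (d * e) *: slice f m j y :> tens (Q :: b) j.
Proof.
move=> Hm Ei' Ej.
pose F (y : tens (N :: b) i) : tens (Q :: b) j := tact [::] (cod1 f) b j j
  (evalat j (tact [::] (dom1 wL) b i i' y : tens (s ++ N :: b) i')).
pose G (y : tens (N :: b) i) : tens (Q :: b) j :=
  (-1) ^ (d * e) *: slice f m j y.
apply: (tens_ext (f := F) (g := G)) y.
- by move=> c u v; rewrite /F gfun_linear evalat_linear gfun_linear.
- move=> c u v; rewrite /G slice_linear scalerDr !scalerA.
  by rewrite [_ * c]mulrC.
move=> [[p n] y] /= Ei; rewrite /F /G.
rewrite slice_pure; last by rewrite Ej Ei' -!addrA [d + i]addrC.
rewrite (tact_head_pure wL (esym (catA s [:: N] b))) //.
rewrite (tlift_comp _ _ (@evalat_linear _ _ _)).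
rewrite (tlift_comp _ _ (@gfun_linear _ _ _ _ _ _ _)).
pose k := e + (p + d).
rewrite /slice_val -(@pappE _ _ _ f _ k k) //; last first.
  by rewrite /k /= addr0 -addrA [d + p]addrC.
rewrite Hm // (lin_scale (@head_pure_linear K Q b j k y)) scalerA sign_sqr scale1r.
(* Expanding w^L n into pure tensors c (x) n' turns both sides into lifts over the same tensor. *)
rewrite -[wL p (p + d) n in RHS]tlift_pure_id.
rewrite (tlift_comp _ _ (@evalat_linear _ _ _)).
rewrite (tlift_comp _ _ (@gfun_linear _ _ _ _ _ _ _)).
rewrite (tlift_comp _ _ (@head_pure_linear K Q b j k y)).
apply: eq_tlift => z; rewrite -[z]pcat_split.
case: (psplit z) => c [n' []] /= Ez.
rewrite (@pcast_catA K s [:: N] b) !evalat_pure //.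
set q := papp _ _.
have Eq : pdeg ((q, (n', tt)) : ptens [:: M; N]) = k.
  by rewrite /k -Ez pdeg_cat addrA.
rewrite pappE //.
apply: (@tact_cod1_pure K [:: M; N] Q f b j j ((q, (n', tt)) : ptens [:: M; N]) y).
by rewrite Eq /k Ej Ei' -Ei -!addrA [d + _]addrC.
Qed.
End Evaluate.

Lemma gcomp_through (K : fieldType) d e (V W X : gspace K) (g : ghom e W X)
    (f : ghom d V W) i j k x :
  i + d = k -> gcomp g f i j x = g k j (f i k x).
Proof. by move=> <-. Qed.

(** * Descent of the coaction to the quotient *)

Section InducedCoaction.
Variables (K : fieldType) (C D : coalgebra K) (M : contramodule C).
Variable N : cdspace C D.
Let MN := [:: con_space M; cd_space N].
Let Cs k := nseq k.-1 (coal_space C).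
Let Ds l := nseq l.-1 (coal_space D).

Lemma contratensor_ev_pure k e (phi : ihom (tens (Cs k)) (con_space M) e) p
    (n : cd_space N p) i j : i = e + p -> j = i + (2 - k%:Z) ->
  contratensor_ev M N k i j
    (pure i ((existT _ e phi, (existT _ p n, tt))
             : ptens [:: ihom (tens (Cs k)) (con_space M); cd_space N])) =
  (-1) ^ ((2 - k%:Z) * e) *:
    evalat phi j (cd_wL N k p (p + (2 - k%:Z)) n).
Proof.
move=> Ei ->; rewrite /contratensor_ev gcomp_val.
have -> := @tact_last_pure K [:: ihom (tens (Cs k)) (con_space M)]
  (Cs k ++ [:: cd_space N]) _ _ (cd_wL N k) i (i + (2 - k%:Z))
  (existT _ e phi, tt) p n; last by rewrite /= addr0.
by rewrite [X in (_ * X)]addr0 linearZ.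
Qed.

Lemma contratensor_t_pure k e (phi : ihom (tens (Cs k)) (con_space M) e) p
    (n : cd_space N p) i j : i = e + p ->
  contratensor_t M N k i j
    (pure i ((existT _ e phi, (existT _ p n, tt))
             : ptens [:: ihom (tens (Cs k)) (con_space M); cd_space N])) =
  pure j ((existT _ (e + (2 - k%:Z)) (con_t M k e (e + (2 - k%:Z)) phi),
           (existT _ p n, tt)) : ptens MN).
Proof.
move=> Ei; rewrite /contratensor_t.
rewrite (tact_head_pure (cod1 (con_t M k)) (erefl MN)) /=; last by rewrite addr0.
rewrite /cod1_fun tlift_pure /= ?addr0 ?eqxx //.
exact: (@rcons_pure_multilinear K [:: con_space M] [:: cd_space N]).
Qed.

Section Along.
Variables (Q : gspace K) (f : ghom 0 (tens MN) Q).

(** The composite prescribed by [induced_comodule]; the summand 0 in its degree comes from [gcomp]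
    and is removed by [ghom_addr0]. *)
Definition coaction l : ghom (2 - l%:Z + 0) (tens MN) (tens (Q :: Ds l)) :=
  gcomp (tact [::] (cod1 f) (Ds l) : ghom 0 (tens (MN ++ Ds l)) _)
        (tact [:: con_space M] (dom1 (cd_wR N l)) [::]).

Lemma coaction_pure l e (m : con_space M e) p (n : cd_space N p) i j :
  i = e + p -> j = i + (2 - l%:Z) ->
  coaction l i j (pure i ((existT _ e m, (existT _ p n, tt)) : ptens MN)) =
  (-1) ^ ((2 - l%:Z) * e) *: slice f m j (cd_wR N l p (p + (2 - l%:Z)) n).
Proof.
move=> Ei ->; rewrite /coaction gcomp_val.
have -> := @tact_last_pure K [:: con_space M] _ _ _ (cd_wR N l) i (i + (2 - l%:Z))
  (existT _ e m, tt) p n; last by rewrite /= addr0.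
rewrite [X in (_ * X)]addr0 linearZ; congr (_ *: _).
by apply: (@tact_cod1_slice K _ _ _ f e m (Ds l)); rewrite Ei -addrA.
Qed.

Lemma coaction_eq0 l i j x : cd_wR N l = 0 -> coaction l i j x = 0.
Proof. by move=> w0; rewrite /coaction gcomp_val w0 dom10 tact0 linear0. Qed.

Hypothesis fM : coequalizes f.

Lemma coequalizes_pure k e (phi : ihom (tens (Cs k)) (con_space M) e) p
    (n : cd_space N p) j : (0 < k)%N -> j = e + (p + (2 - k%:Z)) ->
  f j j (pure j ((existT _ (e + (2 - k%:Z)) (con_t M k e (e + (2 - k%:Z)) phi),
                  (existT _ p n, tt)) : ptens MN)) =
  (-1) ^ ((2 - k%:Z) * e) *:
    f j j (evalat phi j (cd_wL N k p (p + (2 - k%:Z)) n)).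
Proof.
move=> k0 Ej; have := fM k0 j (pure (e + p) ((existT _ e phi, (existT _ p n, tt))
   : ptens [:: ihom (tens (Cs k)) (con_space M); cd_space N])).
have E : e + p + (2 - k%:Z) = j by rewrite Ej -addrA.
have E' : e + p + (2 - k%:Z + 0) = j by rewrite addr0.
rewrite (gcomp_through f _ _ _ E) (gcomp_through f _ _ _ E').
by rewrite contratensor_t_pure // contratensor_ev_pure ?linearZ.
Qed.

Hypothesis hNR : even_family (cd_wR N).
Hypothesis hN : commuting N.

Lemma coaction_coequalizes k l i0 i j z : (0 < k)%N ->
  coaction l i j (contratensor_ev M N k i0 i z) =
  coaction l i j (contratensor_t M N k i0 i z).
Proof.
(* For l odd or zero the coaction vanishes; below, l is even and positive. *)
move=> k0; have [ol|el] := boolP (odd l); first by rewrite !coaction_eq0 // hNR.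
have [l0|] := posnP l; first by rewrite !coaction_eq0 // l0 cd_wR0.
move=> l0; have [Ei|ni] := eqVneq i (i0 + (2 - k%:Z)); last first.
  rewrite [contratensor_t _ _ _ _ _ _]gfun_deg //.
  by rewrite [contratensor_ev _ _ _ _ _ _]gfun_deg ?addr0.
have [Ej|nj] := eqVneq j (i + (2 - l%:Z)); last by rewrite !gfun_deg ?addr0.
pose Z := [:: ihom (tens (Cs k)) (con_space M); cd_space N].
pose F (z : tens Z i0) := coaction l i j (contratensor_ev M N k i0 i z).
pose G (z : tens Z i0) := coaction l i j (contratensor_t M N k i0 i z).
apply: (tens_ext (f := F) (g := G)) z => [c u v|c u v|].
- by rewrite /F !linearP.
- by rewrite /G !linearP.
move=> [[e phi] [[p n] []]] /=; rewrite addr0 => /esym Ep; rewrite /F /G.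
rewrite contratensor_ev_pure // contratensor_t_pure //.
rewrite (lin_scale (@gfun_linear _ _ _ _ (coaction l) i j)).
rewrite coaction_pure //; last by rewrite Ei Ep addrAC.
rewrite (sign_even K _ el) scale1r /coaction (gcomp_through _ _ _ _ (esym Ej)).
rewrite (@tact_evalat K (Cs k) _ _ e phi _ _ _ (p + (2 - k%:Z)) i
  (p + (2 - l%:Z) + (2 - k%:Z)) j); last 2 first.
- by rewrite Ei Ep -addrA.
- by rewrite Ej Ei Ep -!(addrA e) (addrAC p).
rewrite (sign_even K _ el) scale1r.
(* Commutation lets w^R_l act before w^L_k, which exposes w^L_k on the N-factor of w^R_l n. *)
have := hN k0 l0 (p + (2 - l%:Z) + (2 - k%:Z)) n; rewrite !gcomp_val => <-.
rewrite (@tact_cod1_evalat K (Cs k) _ _ e phi Q f _ _ (cd_wL N k)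
  (con_t M k e (e + (2 - k%:Z)) phi)) //; first last.
- by rewrite Ej Ei Ep -!(addrA e) (addrAC p).
- by move=> p' n' k' Ek; apply: coequalizes_pure.
(* One sign comes from w^L_k passing phi in [contratensor_ev], the other from using the relation;
   their product is 1. *)
by rewrite scalerA sign_sqr scale1r.
Qed.
End Along.
End InducedCoaction.

(** * Linearity of sums and pointwise formulas *)

Section LinearSums.
Variables (K : fieldType) (V W : lmodType K).

Lemma linear_bigsum I (r : seq I) (P : pred I) (F : I -> V -> W) :
  (forall i, linear (F i)) -> linear (fun x => \sum_(i <- r | P i) F i x).
Proof.
move=> lF a u v; rewrite scaler_sumr -big_split /=.
by apply: eq_bigr => i _; rewrite lF.
Qed.

Lemma linear_sum2 (F G : V -> W) :
  linear F -> linear G -> linear (fun x => F x + G x).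
Proof. by move=> lF lG a u v; rewrite lF lG scalerDr addrACA. Qed.

Lemma linear_scaled c (F : V -> W) : linear F -> linear (fun x => c *: F x).
Proof. by move=> lF a u v; rewrite lF scalerDr !scalerA [c * a]mulrC. Qed.
End LinearSums.

Lemma tens_ext0 (K : fieldType) s n (Z : lmodType K) (f : tens s n -> Z) :
  linear f -> (forall x, pdeg x = n -> f (pure n x) = 0) -> forall x, f x = 0.
Proof.
move=> lf f0; apply: (tens_ext (g := fun=> 0)) => // c u v.
by rewrite scaler0 addr0.
Qed.

Section Lowered.
Variables (K : fieldType) (d : int) (V W : gspace K) (f : ghom (d + 0) V W).

Fact ghom_addr0_deg i j (x : V i) : j != i + d -> f i j x = 0.
Proof. by move=> ji; apply: gfun_deg; rewrite addr0. Qed.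

Definition ghom_addr0 : ghom d V W := GHom (@gfun_linear _ _ _ _ f) ghom_addr0_deg.
End Lowered.

Lemma ihom_postE (K : fieldType) (V M X : gspace K) (f : ghom 0 M X) e
    (phi : ihom V M e) a b (x : V a) :
  (ihom_post V f e e phi : ghom e V X) a b x = f b b ((phi : ghom e V M) a b x).
Proof.
rewrite /= /ihom_post_val addr0 eqxx.
have [->//|ba] := eqVneq b (a + e).
by rewrite gfun_deg ?addr0 // [X in f b b X]gfun_deg // linear0.
Qed.

Lemma papp_ev (K : fieldType) s (M : gspace K) e (phi : ihom (tens s) M e)
    (c : ptens s) :
  papp (ev s M) ((existT _ e phi, c) : ptens (ihom (tens s) M :: s)) =
  existT _ (e + pdeg c) ((phi : ghom e _ _) (pdeg c) (e + pdeg c) (pure _ c)).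
Proof.
rewrite /papp /= tlift_pure; last exact: ev_val_multilinear.
by rewrite /= eqxx.
Qed.

(** * The contratensor product as a comodule *)

Section ContratensorProduct.
Variables (K : fieldType) (C D : coalgebra K) (N : cdspace C D).
Hypothesis hNR : even_family (cd_wR N).
Hypothesis hN : commuting N.
Implicit Types M : contramodule C.
Let MN M := [:: con_space M; cd_space N].

(** The source degree i0 is unconstrained: unless i = i0 + (2 - k), both images are 0 and the
    relation is trivial. *)
Definition ct_rel M i (u v : tens (MN M) i) : Prop :=
  exists k i0 z, [/\ (0 < k)%N, u = contratensor_ev M N k i0 i z
                   & v = contratensor_t M N k i0 i z].

Definition ct_space M : gspace K := gquot (@ct_rel M).
Definition ct_proj M : ghom 0 (tens (MN M)) (ct_space M) := gproj (@ct_rel M).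

Lemma ct_proj_coequalizes M : coequalizes (ct_proj M).
Proof.
move=> k k0 i j x; pose i' := i + (2 - k%:Z).
have E : i + (2 - k%:Z + 0) = i' by rewrite addr0.
rewrite (gcomp_through _ _ _ _ E) (gcomp_through _ _ _ _ (erefl i')).
have [->|ji] := eqVneq j i'; last by rewrite !gfun_deg ?addr0.
by rewrite !gprojE; apply: mproj_rel; exists k, i, x.
Qed.

Lemma coequalizes_rel M X (f : ghom 0 (tens (MN M)) X) i j (u v : tens (MN M) i) :
  coequalizes f -> ct_rel u v -> f i j u = f i j v.
Proof.
move=> cf [k [i0 [z [k0 -> ->]]]].
have [Ei|ni] := eqVneq i (i0 + (2 - k%:Z)); last first.
  rewrite [contratensor_t _ _ _ _ _ _]gfun_deg //.
  by rewrite [contratensor_ev _ _ _ _ _ _]gfun_deg ?addr0.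
have E : i0 + (2 - k%:Z + 0) = i by rewrite addr0.
have := cf k k0 i0 j z.
by rewrite (gcomp_through _ _ _ _ E) (gcomp_through _ _ _ _ (esym Ei)).
Qed.

Lemma coaction_rel M l i j (u v : tens (MN M) i) :
  ct_rel u v -> coaction (ct_proj M) l i j u = coaction (ct_proj M) l i j v.
Proof.
move=> [k [i0 [z [k0 -> ->]]]].
by apply: coaction_coequalizes => //; apply: ct_proj_coequalizes.
Qed.

Definition ct_w M l :
    ghom (2 - l%:Z) (ct_space M) (tens (ct_space M :: nseq l.-1 (coal_space D))) :=
  ghom_addr0 (glift (@coaction_rel M l)).

Lemma ct_wE M l i j x :
  ct_w M l i j (ct_proj M i i x) = coaction (ct_proj M) l i j x.
Proof. exact: gliftE. Qed.

Lemma ct_w0 M : ct_w M 0 = 0.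
Proof.
apply: ghom_ext => i j; apply: gproj_ind => x.
by rewrite ct_wE coaction_eq0 // cd_wR0.
Qed.

Lemma ct_w_pure M l e (m : con_space M e) p (x : cd_space N p) i j :
  i = e + p -> j = e + (p + (2 - l%:Z)) ->
  ct_w M l i j (ct_proj M i i
    (pure i ((existT _ e m, (existT _ p x, tt)) : ptens (MN M)))) =
  (-1) ^ ((2 - l%:Z) * e) *:
    slice (ct_proj M) m j (cd_wR N l p (p + (2 - l%:Z)) x).
Proof. by move=> Ei Ej; rewrite ct_wE coaction_pure // Ej Ei addrA. Qed.

(** Both w^R_k and g pass m, so the exponent is their total degree times e. The degree j - e on the
    N side is the one that [slice] sends to j. *)
Lemma ct_term_tail M e (m : con_space M e) p (x : cd_space N p) j a s t b k l
    (g : ghom l (tens s) (tens t)) t0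
    (es : a ++ s ++ b = nseq k.-1 (coal_space D)) (et : a ++ t ++ b = t0) :
  gcomp (tact (ct_space M :: a) g b) (ct_w M k) (e + p) j
    (ct_proj M (e + p) (e + p)
       (pure (e + p) ((existT _ e m, (existT _ p x, tt)) : ptens (MN M)))) =
  (-1) ^ ((2 - k%:Z + l) * e) *: slice (ct_proj M) m j
    (gcomp (tact (cd_space N :: a) g b) (cd_wR N k) p (j - e) x
       : tens (cd_space N :: t0) (j - e))
  :> tens (ct_space M :: t0) j.
Proof.
rewrite !gcomp_val ct_w_pure -?addrA // (lin_scale (@gfun_linear _ _ _ _ _ _ _)).
rewrite (slice_tact_tail _ _ _ es et (n' := j - e) _ (erefl _)).
  by rewrite scalerA -signD -mulrDl.
by rewrite addrC subrK.
Qed.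

Lemma ct_term_head M e (m : con_space M e) p (x : cd_space N p) j b k l t0
    (es : b = nseq k.-1 (coal_space D)) (et : nseq l.-1 (coal_space D) ++ b = t0) :
  gcomp (tact [::] (dom1 (ct_w M l)) b) (ct_w M k) (e + p) j
    (ct_proj M (e + p) (e + p)
       (pure (e + p) ((existT _ e m, (existT _ p x, tt)) : ptens (MN M)))) =
  (-1) ^ ((2 - k%:Z + (2 - l%:Z)) * e) *: slice (ct_proj M) m j
    (gcomp (tact [::] (dom1 (cd_wR N l)) b) (cd_wR N k) p (j - e) x
       : tens (cd_space N :: t0) (j - e))
  :> tens (ct_space M :: t0) j.
Proof.
rewrite !gcomp_val ct_w_pure -?addrA // (lin_scale (@gfun_linear _ _ _ _ _ _ _)).
rewrite (@slice_tact_head _ _ _ _ (ct_proj M) e m _ _ _ (cd_wR N l) (ct_w M l)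
  _ _ es et _ (j - e)) -?addrA //.
- by rewrite scalerA -signD -mulrDl.
- by move=> p' v i' j' Ei Ej; apply: ct_w_pure.
- by rewrite addrC subrK.
Qed.

Lemma ct_relP M : rcomod_rel (ct_w M).
Proof.
move=> n n0 i j; apply: gproj_ind; apply: tens_ext0.
  apply: linear_sum2.
    apply: linear_bigsum => p; apply: linear_bigsum => q.
    apply: linear_bigsum => r; apply: linear_scaled => c u v.
    by rewrite !linearP.
  apply: linear_bigsum => b; apply: linear_bigsum => c.
  by apply: linear_scaled => c' u v; rewrite !linearP.
move=> [[e m] [[p x] []]] Ei.
have {}Ei : e + p = i by rewrite -Ei /= addr0.
case: _ / Ei.
(* Each term has total degree 3 - n, being (2 - q) + (2 - (p + 1 + r)) with p + q + r = n, or (2 -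
   b) + (2 - (c + 1)) with b + c = n. Hence one linear map [L] serves for all terms. *)
pose L (y : tens (cd_space N :: nseq n.-1 (coal_space D)) (j - e)) :
    tens (ct_space M :: nseq n.-1 (coal_space D)) j :=
  (-1) ^ ((3 - n%:Z) * e) *: slice (ct_proj M) m j y.
have lL : linear L by apply/linear_scaled/slice_linear.
rewrite -[RHS](lin0 lL) -(cd_wR_relP n0 (j - e) x).
rewrite (lin_add lL) !(lin_sum lL); congr (_ + _); apply: eq_bigr => a _.
  rewrite (lin_sum lL); apply: eq_bigr => b _.
  rewrite (lin_sum lL); apply: eq_bigr => c /and3P[/eqP E a0 b0].
  rewrite (lin_scale lL) /L; congr (_ *: _).
  rewrite ct_term_tail; first by congr (_ ^ (_ * _) *: _); lia.
    by rewrite -[[:: _]]/(nseq 1 _) -!nseqD; congr nseq; lia.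
  by rewrite -!nseqD; congr nseq; lia.
rewrite (lin_sum lL); apply: eq_bigr => c /andP[/eqP E a0].
rewrite (lin_scale lL) /L; congr (_ *: _).
rewrite ct_term_head; first by congr (_ ^ (_ * _) *: _); lia.
  by congr nseq; lia.
by rewrite -nseqD; congr nseq; lia.
Qed.

Definition ct_obj M : rcomodule D := RComodule (ct_w0 M) (@ct_relP M).

Lemma ct_induced M : @induced_comodule K C D M N (ct_obj M) (ct_proj M).
Proof. by move=> l l0 i j x; rewrite gcompE; apply: ct_wE. Qed.

Lemma ct_proj_epi M X (f g : ghom 0 (ct_space M) X) :
  gcomp0 f (ct_proj M) = gcomp0 g (ct_proj M) -> f = g.
Proof.
move=> fg; apply: ghom_ext => i j; apply: gproj_ind => x.
by have := congr1 (fun h : ghom 0 _ _ => h i j x) fg.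
Qed.

Definition ct_lift M X (f : ghom 0 (tens (MN M)) X) (cf : coequalizes f) :
    ghom 0 (ct_space M) X :=
  glift (fun i j u v => @coequalizes_rel M X f i j u v cf).

Lemma ct_liftK M X (f : ghom 0 (tens (MN M)) X) (cf : coequalizes f) :
  gcomp0 (ct_lift cf) (ct_proj M) = f.
Proof. by apply: ghom_ext => i j x; apply: gliftE. Qed.

Lemma ct_is_contratensor M : is_contratensor (ct_proj M).
Proof.
split=> [|X f cf]; first exact: ct_proj_coequalizes.
exists (ct_lift cf); split=> [|g gf]; first exact: ct_liftK.
by apply: ct_proj_epi; rewrite ct_liftK.
Qed.

(** * Functoriality in the contramodule *)

Section Morphism.
Variables (M M' : contramodule C) (f : contra_mor M M').

Definition ct_premap : ghom 0 (tens (MN M)) (tens (MN M')) :=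
  tact [::] (on1 f) [:: cd_space N].

Lemma ct_premap_pure e (m : con_space M e) i j (y : ptens [:: cd_space N]) :
  e + pdeg y = i ->
  ct_premap i j (pure i ((existT _ e m, y) : ptens (MN M))) =
  pure j ((existT _ e (f e e m), y) : ptens (MN M')).
Proof.
move=> E; apply: (@tact_on1_pure K [::] _ _ [:: cd_space N] f i j tt e m y).
by rewrite /= add0r E.
Qed.

Lemma ct_premap_evalat s e (phi : ihom (tens s) (con_space M) e) i j
    (z : tens (s ++ [:: cd_space N]) i) : j = e + i ->
  ct_premap j j (evalat phi j z) = evalat (ihom_post (tens s) f e e phi) j z.
Proof.
move=> Ej; move: z; apply: (tens_ext (f := fun z => ct_premap j j (evalat phi j z))
  (g := evalat (ihom_post (tens s) f e e phi) j)).
- by move=> c u v; rewrite evalat_linear linearP.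
- exact: evalat_linear.
move=> z; rewrite -[z]pcat_split; move: (psplit z).1 (psplit z).2 => c y Ez.
rewrite !evalat_pure // !papp_ev ct_premap_pure; last first.
  by rewrite Ej -Ez pdeg_cat; apply/esym/addrA.
by rewrite ihom_postE.
Qed.

(** Applying f (x) N to the relation for phi gives the relation for f \o phi in the target, since f
    t_k phi = t_k (f \o phi). *)
Lemma ct_premap_coequalizes : coequalizes (gcomp0 (ct_proj M') ct_premap).
Proof.
move=> k k0 i j z; pose i' := i + (2 - k%:Z).
have E : i + (2 - k%:Z + 0) = i' by rewrite addr0.
rewrite (gcomp_through _ _ _ _ E) (gcomp_through _ _ _ _ (erefl i')).
have [->|ji] := eqVneq j i'; last by rewrite !gfun_deg ?addr0.
move: z; apply: tens_ext => [c u v|c u v|[[e phi] [[p n] []]] Ei].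
- by rewrite !linearP.
- by rewrite !linearP.
have {}Ei : i = e + p by rewrite -Ei /= addr0.
rewrite contratensor_ev_pure // contratensor_t_pure //.
have Ei' : i' = e + (p + (2 - k%:Z)) by rewrite /i' Ei -addrA.
change (ct_proj M' i' i' (ct_premap i' i' ((-1) ^ ((2 - k%:Z) * e) *:
    evalat phi i' (cd_wL N k p (p + (2 - k%:Z)) n))) =
  ct_proj M' i' i' (ct_premap i' i' (pure i'
    ((existT _ (e + (2 - k%:Z)) (con_t M k e (e + (2 - k%:Z)) phi),
      (existT _ p n, tt)) : ptens (MN M))))).
rewrite (lin_scale (@gfun_linear _ _ _ _ ct_premap _ _)).
rewrite (lin_scale (@gfun_linear _ _ _ _ (ct_proj M') _ _)) ct_premap_evalat //.
rewrite ct_premap_pure; last by rewrite /= Ei' addr0 -addrA [2 - _ + p]addrC.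
have := contra_funP f k0 (e + (2 - k%:Z)) phi; rewrite gcompE gcomp_val => ->.
by rewrite (coequalizes_pure (@ct_proj_coequalizes M')).
Qed.

Definition ct_map : ghom 0 (ct_space M) (ct_space M') := ct_lift ct_premap_coequalizes.

Lemma ct_mapK : gcomp0 ct_map (ct_proj M) = gcomp0 (ct_proj M') ct_premap.
Proof. exact: ct_liftK. Qed.

Lemma ct_mapE i j x :
  ct_map i j (ct_proj M i i x) = ct_proj M' i j (ct_premap i i x).
Proof. by have := congr1 (fun h : ghom 0 _ _ => h i j x) ct_mapK. Qed.

Lemma ct_map_slice b e (m : con_space M e) i j (y : tens (cd_space N :: b) i) :
  j = e + i ->
  tact [::] (on1 ct_map) b j j (slice (ct_proj M) m j y) =
  slice (ct_proj M') (f e e m) j y :> tens (ct_space M' :: b) j.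
Proof.
move=> Ej; pose F (y : tens (cd_space N :: b) i) : tens (ct_space M' :: b) j :=
  tact [::] (on1 ct_map) b j j (slice (ct_proj M) m j y).
apply: (tens_ext (f := F)) y; last 1 first.
- move=> [[p n] y] Ei; rewrite /F !slice_pure //.
  have E : j = 0 + (e + (p + 0) + pdeg y) by rewrite Ej -Ei add0r addr0 addrA.
  have -> := @tact_on1_pure K [::] _ _ b ct_map j j tt _ _ y E.
  by rewrite ct_mapE ct_premap_pure.
- by move=> c u v; rewrite /F slice_linear linearP.
- exact: slice_linear.
Qed.

Lemma ct_map_compat : @rcom_compat K D (ct_obj M) (ct_obj M') ct_map.
Proof.
move=> l l0 i j; apply: gproj_ind.
rewrite -/(ct_proj M) => x; rewrite gcompE gcomp_val ct_mapE !ct_wE.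
have [->|ji] := eqVneq j (i + (2 - l%:Z)); last by rewrite !gfun_deg ?addr0.
move: x; apply: tens_ext => [c u v|c u v|[[e m] [[p n] []]] Ei].
- by rewrite !linearP.
- by rewrite !linearP.
have {}Ei : i = e + p by rewrite -Ei /= addr0.
rewrite ct_premap_pure ?[pdeg _]addr0 // !coaction_pure //.
rewrite (lin_scale (@gfun_linear _ _ _ _ _ _ _)); congr (_ *: _).
by apply: ct_map_slice; rewrite Ei -addrA.
Qed.

Definition ct_mor : rcom_mor (ct_obj M) (ct_obj M') := RComMor ct_map_compat.
End Morphism.

Definition ct_functor : functor (contra_cat C) (rcom_cat D).
Proof.
refine (@Functor (contra_cat C) (rcom_cat D) ct_obj ct_mor _ _).
- move=> M; apply/rcom_mor_ext/ct_proj_epi/ghom_ext => i j x.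
  (* The right side is the identity composed with the projection, hence the projection itself. *)
  rewrite [RHS](congr1 (fun h : ghom 0 _ _ => h i j x) (gcomp_id _)).
  rewrite [LHS]ct_mapE; congr (ct_proj _ _ _ _); exact: (@tact_on1_id K [::]).
- move=> M1 M2 M3 f g; apply/rcom_mor_ext/ct_proj_epi/ghom_ext => i j x.
  transitivity (ct_map g i j (ct_map f i i (ct_proj M1 i i x))); last by [].
  rewrite ct_mapE ct_mapE [LHS]ct_mapE; congr (ct_proj _ _ _ _).
  exact: (@tact_on1_comp K [::]).
Defined.

Lemma ct_functorP : is_contratensor_functor N ct_functor.
Proof.
exists ct_proj; split=> [M|M|M M' f].
- exact: ct_is_contratensor.
- exact: ct_induced.
- exact: ct_mapK.
Qed.
End ContratensorProduct.

Theorem proposition9p7 (K : fieldType) (C D : coalgebra K) (N : cdspace C D)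
    (hC : even_coalgebra C) (hD : even_coalgebra D)
    (hNL : even_family (cd_wL N)) (hNR : even_family (cd_wR N))
    (hN : commuting N) :
  exists F : functor (contra_cat C) (rcom_cat D), is_contratensor_functor N F.
Proof. by exists (ct_functor hNR hN); apply: ct_functorP. Qed.
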